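(* Let $p\geq 3$ be a prime and $n\geq 2$ an integer. Let $\Phi_{p^n}(T)=\sum_{k=0}^{p-1}T^{p^{n-1}k}\in\mathbb{L}_p[T]$ and run the transfinite Newton algorithm on $\Phi_{p^n}$ (as described in the context), choosing the root $z_0=1$ at step $0$, the root $z_1=(-1)^n\zeta_{2(p-1)}$ at step $1$, and at each step $i\geq 2$ any root $z_i$ of the residue polynomial. Then the $i$-th approximations $\zeta_{p^n}^{(i)}$ satisfy \[\zeta_{p^n}^{(i)}= \begin{cases} \sum_{k=0}^i \frac{(-1)^{kn}}{[k!]}\zeta_{2(p-1)}^k\,p^{\frac{k}{p^{n-1}(p-1)}}, & 0\leq i\leq p-1,\\[1ex] \zeta_{p^n}^{(p-1)}+ \sum_{l=n}^{i-p+n}(-1)^n\zeta_{2(p-1)}\, p^{\frac{1}{p^{n-2}(p-1)}-\frac{1}{p^l}}, & i\geq p. \end{cases}\]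
   Context: $\mathbb{L}_p=W(\bar{\mathbb{F}}_p)((p^{\mathbb{Q}}))$ is the $p$-adic Mal'cev–Neumann field: its elements are formal sums $\alpha=\sum_{x\in\mathbb{Q}}[\alpha_x]p^x$ with $\alpha_x\in\bar{\mathbb{F}}_p$, $[\cdot]$ the Teichmüller lift into $W(\bar{\mathbb{F}}_p)$, and well-ordered support $\{x:\alpha_x\neq0\}$; it is an algebraically closed complete valued field containing $\mathbb{Q}_p$, with valuation $v_p(\alpha)=\min\{x:\alpha_x\neq 0\}$. For $x\in\mathbb{Q}$ write $C_x(\alpha)=\alpha_x\in\bar{\mathbb{F}}_p$. Elements of $\bar{\mathbb{F}}_p$ are identified with their Teichmüller lifts; $\zeta_{2(p-1)}$ is a fixed primitive $2(p-1)$-th root of unity in $\bar{\mathbb{F}}_p$, and $[k!]$ is the Teichmüller lift of $k!\bmod p$. Newton polygon: for $P(T)=\sum_{k=0}^{N}a_kT^{N-k}\in\mathbb{L}_p[T]$ with $a_0\neq0$, $a_N\neq 0$, $\mathrm{NP}(P)$ is the lower boundary of the convex hull of the points $(k,v_p(a_k))$ ($a_k\neq0$). Its vertices are the breakpoints; $m_{\max}$ is the largest breakpoint $<N$, and $s_{\max}=\frac{v_p(a_N)-v_p(a_{m_{\max}})}{N-m_{\max}}$ is the maximal slope. The residue polynomial is $\mathrm{Res}_P(T)=\sum_{k=0}^{N-m_{\max}}C_{v_p(a_{m_{\max}})+s_{\max}(N-m_{\max}-k)}(a_{N-k})\,T^k\in\bar{\mathbb{F}}_p[T]$. Approximations: set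 $\zeta_{p^n}^{(-1)}=0$. For $i\geq 0$ let $\Phi^{(i,n)}(T)=\Phi_{p^n}(T+\zeta_{p^n}^{(i-1)})$; let $s_i$ be the maximal slope of $\mathrm{NP}(\Phi^{(i,n)})$, let $z_i\in\bar{\mathbb{F}}_p$ be a chosen root of $\mathrm{Res}_{\Phi^{(i,n)}}$, and set $\zeta_{p^n}^{(i)}=\zeta_{p^n}^{(i-1)}+[z_i]p^{s_i}$. This $\zeta_{p^n}^{(i)}$ is the $i$-th approximation of $\zeta_{p^n}$. *)

(* Defs.v *)
(* The p-adic Mal'cev--Neumann field L_p = W(Fpbar)((p^Q))
   is realised as the Hahn ring W((t^Q)) (functions Q -> W with well-ordered
   support) modulo the ideal (t - p), where W = W(Fpbar) is given by its
   standard characterisation as the strict p-ring with residue field Fpbar. *)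
From HB Require Import structures.
From mathcomp Require Import all_boot all_order all_algebra.
From Stdlib Require Import ClassicalEpsilon.
Set Implicit Arguments. Unset Strict Implicit. Unset Printing Implicit Defensive.
Import Order.TTheory GRing.Theory Num.Theory.
Local Open Scope ring_scope.

Definition pb (P : Prop) : bool := if excluded_middle_informative P then true else false.

(* k is an algebraic closure of F_p: algebraically closed, characteristic p,
   and every element lies in a finite field F_{p^m}. *)
Definition is_Fpbar (p : nat) (k : closedFieldType) : Prop :=
  (p \in [pchar k]) /\ (forall x : k, exists m : nat, (0 < m)%N /\ x ^+ (p ^ m) = x).

(* Wk together with red : Wk -> k and teich : k -> Wk is the ring of Witt
   vectors W(k): a strict p-ring (p-adically separated and complete, p not a
   zero divisor) with residue ring Wk/pWk = k via red; teich is the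
   multiplicative section of red (the Teichmueller lift). *)
Definition is_Witt (p : nat) (k : closedFieldType) (Wk : comUnitRingType)
  (red : {rmorphism Wk -> k}) (teich : k -> Wk) : Prop :=
  (forall c : k, exists w, red w = c) /\
      (forall w : Wk, red w = 0 <-> exists u, w = p%:R * u) /\
      (forall w : Wk, p%:R * w = 0 -> w = 0) /\
      (forall w : Wk, (forall N : nat, exists u, w = p%:R ^+ N * u) -> w = 0) /\
      (forall a : nat -> Wk, exists w, forall N : nat, exists u,
          w - \sum_(m < N) a m * p%:R ^+ m = p%:R ^+ N * u) /\
      (forall c : k, red (teich c) = c) /\
      (forall a b : k, teich (a * b) = teich a * teich b).

Definition well_ordered (S : rat -> Prop) : Prop :=
  forall T : rat -> Prop, (forall x, T x -> S x) -> (exists x, T x) ->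
    exists m, T m /\ forall y, T y -> m <= y.

Section MalcevNeumann.
Variables (p n : nat) (k : closedFieldType) (Wk : comUnitRingType) (teich : k -> Wk).

Definition hahn (f : rat -> Wk) : Prop := well_ordered (fun x => f x != 0).

(* f and g represent the same element of L_p : f - g lies in (t - p) * Hahn *)
Definition mn_equiv (f g : rat -> Wk) : Prop :=
  exists h : rat -> Wk, hahn h /\ forall y, f y - g y = h (y - 1) - p%:R * h y.

Definition teich_exp (f : rat -> Wk) (alpha : rat -> k) : Prop :=
  hahn f /\ forall x, f x = teich (alpha x).

(* Finite formal sums  sum a_j p^{x_j}  (a_j in Wk, x_j in Q), i.e. elements
   of L_p presented by finite expressions.  (x, a) stands for a * p^x. *)
Definition fsum := seq (rat * Wk).
Definition fsF (g : fsum) : rat -> Wk := fun y => \sum_(e <- g | e.1 == y) e.2.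
Definition fs0 : fsum := [::].
Definition fs1 : fsum := [:: (0, 1)].
Definition fsadd (g h : fsum) : fsum := g ++ h.
Definition fsscale (c : Wk) (g : fsum) : fsum := [seq (e.1, c * e.2) | e <- g].
Definition fsmul (g h : fsum) : fsum := [seq (e.1 + f.1, e.2 * f.2) | e <- g, f <- h].
Definition fsexp (g : fsum) (m : nat) : fsum := iter m (fsmul g) fs1.
Definition fsbig (m : nat) (F : nat -> fsum) : fsum := flatten [seq F j | j <- iota 0 m].

Definition Leq (g h : fsum) : Prop := mn_equiv (fsF g) (fsF h).
Definition Lnz (g : fsum) : Prop := ~ mn_equiv (fsF g) (fun _ => 0).

Definition Cx (x : rat) (g : fsum) : k :=
  epsilon (inhabits 0) (fun c => exists alpha, exists f,
     teich_exp f alpha /\ mn_equiv f (fsF g) /\ alpha x = c).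

Definition vp (g : fsum) : rat :=
  epsilon (inhabits 0) (fun v => exists alpha, exists f,
     teich_exp f alpha /\ mn_equiv f (fsF g) /\ alpha v != 0 /\
     forall y, y < v -> alpha y = 0).

(* Newton polygon of P(T) = sum_{j=0}^N a_j T^{N-j}: the vertices
   (breakpoints) of the lower convex hull of {(j, v_p(a_j)) : a_j <> 0}. *)
Definition np_vertex (N : nat) (a : nat -> fsum) (j : nat) : Prop :=
  (j <= N)%N /\ Lnz (a j) /\ exists s : rat, forall m : nat, (m <= N)%N -> m != j ->
    Lnz (a m) -> vp (a j) + s * (m%:R - j%:R) < vp (a m).

Definition m_max (N : nat) (a : nat -> fsum) : nat :=
  (\max_(j < N | pb (np_vertex N a j)) (j : nat))%N.

Definition s_max (N : nat) (a : nat -> fsum) : rat :=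
  (vp (a N) - vp (a (m_max N a))) / (N - m_max N a)%:R.

Definition res_poly (N : nat) (a : nat -> fsum) : {poly k} :=
  \poly_(j < (N - m_max N a).+1)
     Cx (vp (a (m_max N a)) + s_max N a * (N - m_max N a - j)%:R) (a (N - j)%N).

(* Phi_{p^n}(T) = sum_{j<p} T^{p^{n-1} j} has degree N = p^{n-1}(p-1);
   the coefficient a_m of T^{N-m} in Phi_{p^n}(T + b) is
   sum_{j<p} binom(p^{n-1} j, N-m) b^{p^{n-1} j - (N-m)}. *)
Definition degN : nat := (p ^ n.-1 * p.-1)%N.
Definition phi_shift (b : fsum) (m : nat) : fsum :=
  fsbig p (fun j => fsscale ('C(p ^ n.-1 * j, degN - m))%:R
                            (fsexp b (p ^ n.-1 * j - (degN - m)))).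

(* approx z i = zeta_{p^n}^{(i-1)}  (approx z 0 = zeta^{(-1)} = 0), with the
   choices z i of roots of the residue polynomials. *)
Fixpoint approx (z : nat -> k) (i : nat) : fsum :=
  match i with
  | 0 => fs0
  | i'.+1 => fsadd (approx z i')
        [:: (s_max degN (phi_shift (approx z i')), teich (z i'))]
  end.

Definition residue_at (z : nat -> k) (i : nat) : {poly k} :=
  res_poly degN (phi_shift (approx z i)).

Definition rhs1 (zeta : k) (i : nat) : fsum :=
  fsbig i.+1 (fun j => [:: ((j%:R / (p ^ n.-1 * p.-1)%:R : rat),
       (-1) ^+ (j * n) * (teich (j`!%:R))^-1 * teich zeta ^+ j)]).

Definition rhs2 (zeta : k) (i : nat) : fsum :=
  fsbig (i - p + n).+1 (fun l => if (l < n)%N then fs0 else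
     [:: ((1 / (p ^ (n - 2) * p.-1)%:R - 1 / (p ^ l)%:R : rat),
          (-1) ^+ n * teich zeta)]).

End MalcevNeumann.

(* Main.v *)
From HB Require Import structures.
From mathcomp Require Import all_boot all_order all_algebra.
From mathcomp Require Import ring lra zify.
From Stdlib Require Import ClassicalEpsilon.
Require Import Defs.
Set Implicit Arguments. Unset Strict Implicit. Unset Printing Implicit Defensive.
Import Order.TTheory GRing.Theory Num.Theory.
Local Open Scope ring_scope.

(** Valuations and residues of finite sums with exponents in [M^-1 * Z] are read off
in [A = W[X]/(X^M - p)], where [X = p^(1/M)] is a uniformizer with residue field [k].
Put [q = p^(n-1)], let [b] be an approximation and substitute [T = p^s U], [s] being the
expected next exponent.  Comparing leading forms in [A[U]] of both sides of
[((b + T)^q - 1) * Phi_(p^n)(b + T) = (b + T)^(p q) - 1] gives the leading form of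
[Phi_(p^n)(b + p^s U)], a constant times [U^q - z^q] with [z] the expected digit; this
determines the last side of the Newton polygon and the residue polynomial, whose only
root is [z] as Frobenius is injective.  The input is [b^q]: with [w^(p-1) = -p] the
truncated exponential [E(w)] satisfies [E(w)^p = 1] up to valuation [2 + 1/(p-1)], and
[b^q = E(w) - (z p^s)^q + ...].  Adding the tail term [t = z p^s] to [b] changes [b^q] by
[t^q + p t^(q/p)]: the first summand cancels the error, the second is the next error. *)

(** * Leading forms with respect to a uniformizer *)

(** [E(w)] can stand in for a primitive p-th root of unity because a step needs [(b + T)^(p q) - 1]
    only up to valuation [1 + q s], which stays below [2 + 1/(p-1)]: along the tail [q s] increases
    towards [p/(p-1)] without reaching it. The tail exponents have unbounded denominators, so no
    single [M] serves all steps; every step is carried out in its own ring, and results are compared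
    only as formal sums. Since [vp] and [Cx] are chosen by [epsilon], nothing can be read off before
    Teichmüller expansions are known to exist for finite sums and to be unique modulo [t - p]. Steps
    0 and 1 fall outside the pattern: there the polygon has a single side of width [deg Phi], and at
    step 1 the residue polynomial has [p - 1] distinct roots, which is where a choice is made. From
    step 2 on the side has width [q] and the digit is forced. *)

Section LeadingForms.
Variables (A K : comNzRingType) (rho : {rmorphism A -> K}) (u : A).

Definition dv (c : nat) (f : A) := exists g, f = u ^+ c * g.

(** [F] may be zero. This keeps [lead] additive without cases on cancellation and lets all
    coefficients of a polynomial share one exponent [c]. *)
Definition lead (c : nat) (f : A) (F : K) := exists2 g, f = u ^+ c * g & rho g = F.

Lemma dv_add c f g : dv c f -> dv c g -> dv c (f + g).
Proof. by move=> [a ->] [b ->]; exists (a + b); rewrite mulrDr. Qed.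

Lemma dv_le c d f : (d <= c)%N -> dv c f -> dv d f.
Proof.
move=> le_dc [a ->]; exists (u ^+ (c - d) * a).
by rewrite mulrA -exprD subnKC.
Qed.

Lemma dv_mul c d f g : dv c f -> dv d g -> dv (c + d) (f * g).
Proof. by move=> [a ->] [b ->]; exists (a * b); rewrite exprD mulrACA. Qed.

Lemma dv_mulr c f g : dv c f -> dv c (f * g).
Proof. by move=> [a ->]; exists (a * g); rewrite mulrA. Qed.

Lemma dv_mull c f g : dv c f -> dv c (g * f).
Proof. by rewrite mulrC; apply: dv_mulr. Qed.

Lemma dv_exp c m f : dv c f -> dv (c * m) (f ^+ m).
Proof. by move=> [a ->]; exists (a ^+ m); rewrite exprMn exprM. Qed.

Lemma dv_base c : dv c (u ^+ c).
Proof. by exists 1; rewrite mulr1. Qed.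

Lemma dv0 c : dv c 0.
Proof. by exists 0; rewrite mulr0. Qed.

Lemma dv_sum c (I : Type) (r : seq I) (P : pred I) (F : I -> A) :
  (forall i, P i -> dv c (F i)) -> dv c (\sum_(i <- r | P i) F i).
Proof. move=> H; apply: big_ind => //; [exact: dv0 | exact: dv_add]. Qed.

Lemma lead_dv c f F : lead c f F -> dv c f.
Proof. by case=> g -> _; exists g. Qed.

Lemma lead_add c f g F G : lead c f F -> lead c g G -> lead c (f + g) (F + G).
Proof.
by move=> [a -> <-] [b -> <-]; exists (a + b); rewrite ?mulrDr ?rmorphD.
Qed.

Lemma lead_opp c f F : lead c f F -> lead c (- f) (- F).
Proof. by move=> [a -> <-]; exists (- a); rewrite ?mulrN ?rmorphN. Qed.

Lemma lead_mul c d f g F G :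
  lead c f F -> lead d g G -> lead (c + d) (f * g) (F * G).
Proof.
move=> [a -> <-] [b -> <-]; exists (a * b); last by rewrite rmorphM.
by rewrite exprD mulrACA.
Qed.

Lemma lead_exp c m f F : lead c f F -> lead (c * m) (f ^+ m) (F ^+ m).
Proof.
by move=> [a -> <-]; exists (a ^+ m); [rewrite exprMn exprM | rewrite rmorphXn].
Qed.

Lemma lead_unit f : lead 0 f (rho f).
Proof. by exists f; rewrite ?expr0 ?mul1r. Qed.

Hypothesis rho_u : rho u = 0.

Lemma dv_lead0 c f : dv c.+1 f -> lead c f 0.
Proof.
move=> [a ->]; exists (u * a); first by rewrite exprSr mulrA.
by rewrite rmorphM rho_u mul0r.
Qed.

Lemma lead_congr c f g F : lead c f F -> dv c.+1 (g - f) -> lead c g F.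
Proof.
move=> lf /dv_lead0 lg; have := lead_add lf lg.
by rewrite addr0 [f + _]addrC subrK.
Qed.

End LeadingForms.

(** * Division of leading forms *)

Section Division.
Variables (A : comNzRingType) (K : idomainType) (rho : {rmorphism A -> K}) (u : A).

(** These properties suffice for division and pass to polynomials with [u] as a constant, where
    [{poly K}] is still a domain but no longer a residue field. *)
Record uniformizer : Prop := Uniformizer {
  unif_reg : forall f, u * f = 0 -> f = 0;
  unif_red : rho u = 0;
  unif_ker : forall f, rho f = 0 -> exists g, f = u * g }.

Hypothesis U : uniformizer.

Lemma unifX_reg m f : u ^+ m * f = 0 -> f = 0.
Proof.
elim: m => [|m IH]; first by rewrite expr0 mul1r.
by rewrite exprS -mulrA => /(unif_reg U).
Qed.

Lemma unifX_inj m f g : u ^+ m * f = u ^+ m * g -> f = g.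
Proof.
move=> e; apply/eqP; rewrite -subr_eq0; apply/eqP/(@unifX_reg m).
by rewrite mulrBr e subrr.
Qed.


(** After [u ^+ c] is cancelled, [f1 * g = u ^+ d * h] with [rho f1 = F]. While [d] is positive,
    [F * rho g = 0] in a domain, so one factor [u] can be stripped from [g]; at [d = 0] residues are
    compared. *)
Lemma lead_divide (c d : nat) (f g : A) (F G : K) :
  F != 0 -> lead rho u c f F -> lead rho u (c + d) (f * g) (F * G) ->
  lead rho u d g G.
Proof.
move=> F0 [f1 -> rf1] [h e rh].
have {}e : f1 * g = u ^+ d * h.
  by apply: (@unifX_inj c); rewrite !mulrA -exprD e.
elim: d g e => [|d IH] g e.
  exists g; rewrite ?expr0 ?mul1r //; apply: (mulfI F0).
  by rewrite -rh -rf1 -rmorphM e expr0 mul1r.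
have [g' eg] : exists g', g = u * g'.
  apply: (unif_ker U); apply: (mulfI F0); rewrite mulr0 -rf1 -rmorphM e.
  by rewrite exprS !rmorphM (unif_red U) !mul0r.
have [|g2 eg2 rg2] := IH g'.
  by apply: (@unifX_inj 1); rewrite expr1 mulrCA -eg e exprS mulrA.
by exists g2 => //; rewrite eg eg2 exprS mulrA.
Qed.

End Division.

Section PolynomialExtension.
Variables (A : comNzRingType) (K : idomainType) (rho : {rmorphism A -> K}) (u : A).

Lemma uniformizer_poly :
  uniformizer rho u -> uniformizer (map_poly rho : {rmorphism {poly A} -> {poly K}}) u%:P.
Proof.
case=> ureg ured uker; split.
- move=> f /polyP f0; apply/polyP=> i; rewrite coef0; apply: ureg.
  by have := f0 i; rewrite coefCM coef0.
- by rewrite /= map_polyC /= ured.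
- move=> f /= /polyP f0.
  have [g gP] : exists g : 'I_(size f) -> A, forall i : 'I_(size f), f`_i = u * g i.
    apply: (fin_all_exists (P := fun i a => f`_(i : 'I_(size f)) = u * a)) => i.
    by apply: uker; have := f0 i; rewrite coef_map coef0.
  exists (\poly_(i < size f) (if insub i is Some j then g j else 0)).
  apply/polyP=> i; rewrite coefCM coef_poly.
  case: ltnP => [lti|gei]; last by rewrite mulr0 nth_default.
  by rewrite insubT (gP (Ordinal lti)).
Qed.

Lemma lead_polyC c f F :
  lead rho u c f F -> lead (map_poly rho) u%:P c f%:P F%:P.
Proof.
case=> g -> <-; exists g%:P; first by rewrite polyCM rmorphXn.
by rewrite /= map_polyC.
Qed.

Lemma dv_polyC c f : dv u c f -> dv u%:P c f%:P.
Proof. by case=> g ->; exists g%:P; rewrite polyCM rmorphXn. Qed.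

Lemma lead_coef_poly c (f : {poly A}) (F : {poly K}) :
  lead (map_poly rho) u%:P c f F -> forall i, lead rho u c f`_i F`_i.
Proof.
case=> g -> <- i; exists g`_i; last by rewrite /= coef_map.
by rewrite -rmorphXn coefCM.
Qed.

End PolynomialExtension.

(** * p-th powers and the truncated exponential *)

Section PrimePowers.
Variables (p : nat) (p_pr : prime p).

(** The linear term and [h ^+ p] are kept apart from the remainder because, depending on the
    valuation of [h], either can dominate. *)
Lemma binomial_first_order (R : comNzRingType) (a h : R) : exists r,
  (a + h) ^+ p = a ^+ p + p%:R * a ^+ p.-1 * h + p%:R * h ^+ 2 * r + h ^+ p.
Proof.
case: p p_pr => [|[|m]] // pr.
(* Here [p = m.+2], and the index [i] stands for the exponent [i.+2] of [h]. *)
exists (\sum_(i < m) a ^+ (m - i) * h ^+ i *+ ('C(m.+2, i.+2) %/ m.+2)).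
rewrite exprDn.
under eq_bigr do rewrite -mulr_natl.
rewrite big_ord_recl big_ord_recl big_ord_recr.
rewrite ![nat_of_ord _]/= ![bump _ _]/= !subSS !subn0 subnn !expr0 bin0 binn bin1 expr1.
rewrite !mul1r mulr1 addrA -[in RHS]addrA mulrA; congr (_ + (_ + _)).
rewrite mulr_sumr; apply: eq_bigr => i _; rewrite -mulr_natl.
have d : (m.+2 %| 'C(m.+2, i.+2))%N by apply: prime_dvd_bin => //=; rewrite !ltnS.
by rewrite -{1}(divnK d) natrM /= !subSS !exprS; ring.
Qed.

Lemma frobenius_mod2 (R : comNzRingType) (e : nat) (a b : R) :
  exists r, (a + b) ^+ (p ^ e) = a ^+ (p ^ e) + b ^+ (p ^ e) + p%:R * r.
Proof.
elim: e => [|e [r IH]]; first by exists 0; rewrite !expn0 !expr1 mulr0 addr0.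
rewrite expnSr !exprM IH.
set A := a ^+ _; set B := b ^+ _.
have [r1 ->] := binomial_first_order (A + B) (p%:R * r).
have [r2 ->] := binomial_first_order A B.
have -> : (p%:R * r) ^+ p = p%:R * (p%:R ^+ p.-1 * r ^+ p).
  by rewrite exprMn -{2}(prednK (prime_gt0 p_pr)) exprS mulrA.
set s := _ ^+ p.-1 * r ^+ p; set t := (A + B) ^+ p.-1; set w := A ^+ p.-1.
exists (w * B + B ^+ 2 * r2 + t * p%:R * r + p%:R ^+ 2 * r ^+ 2 * r1 + s); ring.
Qed.

Lemma frobenius_mod (R : comNzRingType) (e m : nat) (F : nat -> R) :
  exists r, (\sum_(i < m) F i) ^+ (p ^ e) = \sum_(i < m) F i ^+ (p ^ e) + p%:R * r.
Proof.
elim: m => [|m [r IH]].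
  by exists 0; rewrite !big_ord0 mulr0 addr0 expr0n expn_eq0 -leqn0 leqNgt prime_gt0.
have [r' ] := frobenius_mod2 e (\sum_(i < m) F i) (F m).
rewrite !big_ord_recr /= => ->; rewrite IH; exists (r + r'); ring.
Qed.

(** A [p]-th power turns a congruence modulo [p] into one modulo [p ^ 2]: the linear term gains a
    factor [p], and [(p r)^p] contains at least two. *)
Lemma expp_mod_sqr (R : comNzRingType) (g r : R) :
  exists r', (g + p%:R * r) ^+ p = g ^+ p + p%:R ^+ 2 * r'.
Proof.
have [s ->] := binomial_first_order g (p%:R * r).
have -> : (p%:R * r) ^+ p = p%:R ^+ 2 * (p%:R ^+ (p - 2) * r ^+ p).
  by rewrite exprMn mulrA -exprD subnKC // prime_gt1.
set t := _ ^+ (p - 2) * _; set w := g ^+ p.-1.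
exists (w * r + p%:R * r ^+ 2 * s + t); ring.
Qed.

(** Frobenius modulo [p] handles the exponent [p ^ e]; the last [p]-th power raises the precision to
    [p ^ 2]. New terms of a prefix and the polynomial variable are both treated as such a [t]. *)
Lemma expand_power (R : comNzRingType) (e : nat) (b t : R) : exists r r',
  (b + t) ^+ (p ^ e.+1) = b ^+ (p ^ e.+1) + t ^+ (p ^ e.+1)
    + p%:R * (b ^+ (p ^ e)) ^+ p.-1 * t ^+ (p ^ e)
    + p%:R * (t ^+ (p ^ e)) ^+ 2 * r + p%:R ^+ 2 * r'.
Proof.
rewrite expnSr !exprM; have [r0 ->] := frobenius_mod2 e b t.
have [r' ->] := expp_mod_sqr (b ^+ (p ^ e) + t ^+ (p ^ e)) r0.
have [r ->] := binomial_first_order (b ^+ (p ^ e)) (t ^+ (p ^ e)).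
exists r, r'; set x := _ ^+ p.-1; ring.
Qed.

End PrimePowers.

(** * The p-th power of the truncated exponential *)

Section TruncatedExponential.
Variables (p : nat) (p_pr : prime p) (W : comNzRingType).
Hypothesis p_reg : forall w : W, p%:R * w = 0 -> w = 0.
Variable c : nat -> W.
Hypothesis c0 : c 0%N = 1.
Hypothesis cS : forall k, (k.+1 < p)%N -> exists d, k.+1%:R * c k.+1 = c k + p%:R * d.
Hypothesis cp : forall k, (k < p)%N -> c k ^+ p = c k.

Lemma dvp_coprime_cancel (m : nat) (w : W) : (0 < m < p)%N ->
  (exists t, m%:R * w = p%:R * t) -> exists t, w = p%:R * t.
Proof.
move=> /andP[m0 mp] [t e].
have co : coprime m p by rewrite coprime_sym prime_coprime // gtnNdvd.
have [a b ab _] := egcdnP p m0.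
rewrite (eqP co) in ab.
exists (a%:R * t - b%:R * w).
have : (a * m)%:R * w = (b * p + 1)%:R * w by rewrite ab.
rewrite natrD !natrM -mulrA e => h.
rewrite mulrBr mulrCA h; ring.
Qed.

(* The derivative of [E ^+ p] satisfies the differential equation of
   [exp (p * 'X)] up to degree [p - 1] and modulo [p ^ 2]. *)
Lemma truncexp_pow : exists R S : {poly W},
  (\poly_(k < p) c k) ^+ p = \sum_(k < p) c k *: 'X^(k * p) + p%:R * 'X
     + p%:R ^+ 2 * 'X * R + p%:R * 'X^p * S.
Proof.
set E := \poly_(k < p) c k; set G := E ^+ p.
have p_gt0 := prime_gt0 p_pr; have p_gt1 := prime_gt1 p_pr.
have pcoef (f : {poly W}) i : (p%:R * f)`_i = p%:R * f`_i.
  by rewrite -polyC_natr coefCM.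
have [H GH] : exists H : {poly W}, G = \sum_(k < p) c k *: 'X^(k * p) + p%:R * H.
  have [H HP] := frobenius_mod p_pr 1 p (fun k => c k *: 'X^k).
  exists H; move: HP; rewrite /G /E poly_def expn1 => ->; congr (_ + _).
  by apply: eq_bigr => k _; rewrite exprZn cp // -exprM.
have G0 k : (0 < k < p)%N -> G`_k = p%:R * H`_k.
  move=> /andP[k0 kp]; rewrite GH coefD pcoef coef_sum big1 ?add0r // => i _.
  rewrite coefZ coefXn; case: eqP => [ek|]; last by rewrite mulr0.
  by case: (nat_of_ord i) ek => [|j] ek; lia.
have H0 : H`_0 = 0.
  apply: p_reg; rewrite -pcoef.
  have -> : p%:R * H = G - \sum_(k < p) c k *: 'X^(k * p) by rewrite GH addrC addKr.
  rewrite coefB -horner_coef0 horner_exp horner_coef0 coef_poly p_gt0 c0 expr1n.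
  rewrite coef_sum -(prednK p_gt0) big_ord_recl big1 /=.
    by rewrite coefZ coefXn eqxx mulr1 c0 addr0 subrr.
  by move=> i _; rewrite coefZ coefXn /bump leq0n add1n mulSn addSn mulr0.
have [d dP] : exists d : 'I_p.-1 -> W, forall k : 'I_p.-1,
    k.+1%:R * c k.+1 = c k + p%:R * d k.
  apply: (fin_all_exists (P := fun (k : 'I_p.-1) d => k.+1%:R * c k.+1 = c k + p%:R * d)).
  by move=> k; apply: cS; rewrite -ltn_predRL.
pose Q := \poly_(k < p.-1) (if insub k is Some j then d j else 0).
(* The monomial is the truncation defect, invisible in the recurrence below degree [p.-1]; [Q]
   collects the errors of the coefficient recurrence modulo [p]. *)
have dE : E^`() = E - c p.-1 *: 'X^(p.-1) + p%:R * Q.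
  apply/polyP=> k; rewrite coef_deriv coefD coefB pcoef coefZ coefXn !coef_poly.
  have [ltk|] := ltnP k p.-1.
    have -> : (k.+1 < p)%N by rewrite -ltn_predRL.
    have -> : (k < p)%N by lia.
    rewrite insubT (ltn_eqF ltk) mulr0 subr0 -(dP (Ordinal ltk)) /=.
    by rewrite mulr_natl.
  move=> gek; have -> : (k.+1 < p)%N = false by lia.
  rewrite mul0rn mulr0 addr0; case: (ltngtP k p.-1) gek => // [gtk|->] _.
    by rewrite (_ : (k < p)%N = false) ?mulr0 ?subr0 //; lia.
  by rewrite ltn_predL p_gt0 mulr1 subrr.
have recG k : (k < p.-1)%N ->
    k.+1%:R * G`_k.+1 = p%:R * (G`_k + p%:R * (Q * E ^+ p.-1)`_k).
  move=> ltk; rewrite mulr_natl -coef_deriv /G deriv_exp dE.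
  rewrite -mulr_natl pcoef; congr (_ * _).
  rewrite !mulrDl mulNr -exprS (prednK p_gt0) !coefD coefN -!mulrA pcoef.
  by rewrite -scalerAl coefZ coefXnM ltk mulr0 subr0.
have pinj (a b : W) : p%:R * a = p%:R * b -> a = b.
  move=> e; apply/eqP; rewrite -subr_eq0; apply/eqP/p_reg.
  by rewrite mulrBr e subrr.
(* In degrees 1 to [p - 1], [G] is [p%:R * H]. The recurrence from the constant term 1 makes the
   coefficient of [H] in degree 1 congruent to 1; in a higher degree [k] it makes [p] divide [k]
   times the coefficient, and [k] is prime to [p]. *)
have Hk k : (k < p)%N -> exists t, (H - 'X)`_k = p%:R * t.
  case: k => [|k] kp; first by exists 0; rewrite coefB H0 coefX subr0 mulr0.
  have := recG k; rewrite -ltnS prednK // => /(_ kp).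
  case: k kp => [|k] kp.
    rewrite mul1r G0 // => /pinj e1.
    exists (Q * E ^+ p.-1)`_0; rewrite coefB e1 /G coefX /=.
    rewrite -[(E ^+ p)`_0]horner_coef0 horner_exp horner_coef0 coef_poly p_gt0 c0 expr1n.
    by rewrite addrC addKr.
  rewrite coefB coefX subr0 !G0 ?kp ?(ltnW kp) //.
  rewrite mulrCA -mulrDr => /pinj e.
  by apply: (@dvp_coprime_cancel k.+2) => //; exists (H`_k.+1 + (Q * E ^+ p.-1)`_k.+1).
have [t tP] : exists t : 'I_p -> W, forall k : 'I_p, (H - 'X)`_k = p%:R * t k.
  by apply: (fin_all_exists (P := fun (k : 'I_p) t => (H - 'X)`_k = p%:R * t)) => k; exact: Hk.
(* The shift by one takes out a factor ['X], as [H - 'X] has zero constant term. *)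
pose R := \poly_(k < p.-1) (if insub k.+1 is Some j then t j else 0).
exists R, (drop_poly p (H - 'X)).
have eqR : p%:R * R * 'X = take_poly p (H - 'X).
  apply/polyP=> k; rewrite coefMX coef_take_poly.
  case: k => [|k] /=; first by rewrite p_gt0 coefB H0 coefX subr0.
  rewrite pcoef coef_poly -ltn_predRL; case: ltnP => [ltk|_]; last by rewrite mulr0.
  have ltk' : (k.+1 < p)%N by rewrite -ltn_predRL.
  by rewrite insubT (tP (Ordinal ltk')).
have eqH : H = 'X + (p%:R * R * 'X + drop_poly p (H - 'X) * 'X^p).
  by rewrite eqR poly_take_drop addrC subrK.
rewrite GH {1}eqH; ring.
Qed.

End TruncatedExponential.

(** * The cluster of roots around an approximation *)

Section ClusterOfRoots.
Variables (p e l : nat) (p_pr : prime p) (p_gt2 : (2 < p)%N).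
Variables (A : comNzRingType) (K : fieldType) (rho : {rmorphism A -> K}) (u : A).
Hypothesis U : uniformizer rho u.

(* Here [n = e + 2]; exponents of [u] are valuations in units of [1/M]. *)
Let q := (p ^ e.+1)%N.
Let h := (p ^ (e + l))%N.
Let M := (p * h * p.-1)%N.

Hypothesis uM : u ^+ M = p%:R.
Variables (a : A) (C : nat -> A).
Hypothesis ap : a ^+ p.-1 = -1.
Hypotheses (C0 : C 0%N = 1) (C1 : C 1%N = 1).
Hypothesis Cp : forall k, (k < p)%N -> C k ^+ p = C k.

Definition truncexp (x : A) := \sum_(k < p) C k * x ^+ k.

Hypothesis truncexpX : forall x, exists r s,
  truncexp x ^+ p = \sum_(k < p) C k * x ^+ (k * p) + p%:R * x
    + p%:R ^+ 2 * x * r + p%:R * x ^+ p * s.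

(** With [p] of valuation 1, the valuations of [x], [y], [w] are [1/(q(p-1))], [1/(p(p-1))] and
    [1/(p-1)]; [x] is the index-1 term of the expansion. *)
Let x := a * u ^+ (p ^ l).
Let y := x ^+ (p ^ e).
Let w := x ^+ q.
Let Ys := truncexp w.

Let h_gt0 : (0 < h)%N. Proof. by rewrite expn_gt0 prime_gt0. Qed.

Let qE : (q = p * p ^ e)%N. Proof. by rewrite /q expnS. Qed.
Let hE : (h = p ^ e * p ^ l)%N. Proof. by rewrite /h expnD. Qed.
Let qlE : (p ^ l * q = p * h)%N. Proof. by rewrite qE hE; lia. Qed.
Let leM : (p * h + p * h <= M)%N.
Proof. by rewrite addnn -muln2 /M leq_mul2l; lia. Qed.

Lemma odd_expp m : odd (p ^ m).
Proof. by rewrite oddX; case: (even_prime p_pr) p_gt2 => [->|->] //; rewrite orbT. Qed.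

Let al := a ^+ (p ^ e).

Lemma alpha_pred : al ^+ p.-1 = -1.
Proof. by rewrite /al exprAC ap -signr_odd odd_expp. Qed.

(** One more [p]-th power multiplies [al] by [al ^+ p.-1 = -1]. This sign is why a tail term with
    the same digit [a] cancels an error [al * u ^+ _]. *)
Lemma a_expq : a ^+ q = - al.
Proof.
by rewrite /q expnSr exprM -/al -(prednK (prime_gt0 p_pr)) exprSr alpha_pred mulN1r.
Qed.

Lemma rho_a_neq0 : rho a != 0.
Proof.
apply/eqP => a0; have /(congr1 rho) := ap; rewrite rmorphXn a0 rmorphN rmorph1 expr0n.
have -> : (p.-1 == 0)%N = false by case: p p_gt2 => [|[|[]]].
by move/esym/eqP; rewrite oppr_eq0 oner_eq0.
Qed.

Lemma y_val : y = al * u ^+ h.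
Proof. by rewrite /y /x exprMn -exprM [in LHS]mulnC /h expnD. Qed.

Lemma w_y : w = y ^+ p.
Proof. by rewrite /y -exprM -expnSr. Qed.

Lemma w_val : w = a ^+ q * u ^+ (p * h).
Proof. by rewrite /w /x exprMn -exprM qlE. Qed.

Lemma w_pred : w ^+ p.-1 = - p%:R.
Proof.
rewrite w_val a_expq exprMn -exprM -/M uM exprNn alpha_pred.
rewrite -signr_odd; have := odd_expp 1; rewrite expn1 => op.
by rewrite (_ : odd p.-1 = false) ?expr0 ?mul1r ?mulN1r //; lia.
Qed.

Lemma w_p : w ^+ p = - (p%:R * w).
Proof. by rewrite -(prednK (prime_gt0 p_pr)) exprSr w_pred mulNr (prednK (prime_gt0 p_pr)). Qed.

Lemma dv_p : dv u M p%:R.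
Proof. by rewrite -uM; apply: dv_base. Qed.

Lemma dv_x : dv u (p ^ l) x.
Proof. by rewrite /x; apply: dv_mull; apply: dv_base. Qed.

Lemma dv_y : dv u h y.
Proof. by rewrite y_val; apply: dv_mull; apply: dv_base. Qed.

Lemma dv_w : dv u (p * h) w.
Proof. by rewrite w_val; apply: dv_mull; apply: dv_base. Qed.

Lemma truncexp_split2 t : exists r, truncexp t = 1 + t + t ^+ 2 * r.
Proof.
rewrite /truncexp; case: p p_gt2 => [|[|m]] // _.
exists (\sum_(k < m) C k.+2 * t ^+ k).
rewrite 2!big_ord_recl C0 expr0 mul1r /= C1 mul1r expr1 -addrA; congr (_ + (_ + _)).
rewrite mulr_sumr; apply: eq_bigr => i _; rewrite /= /bump /= !add1n !exprS; ring.
Qed.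

(** By [w ^+ p = - (p%:R * w)] the sum of the [C k * w ^+ (k * p)] is the truncated exponential of
    [-pw]. Its linear term cancels [p%:R * w], and every remaining term contains [p^2 w]. *)
Lemma Ystar_pow : dv u (2 * M + p * h) (Ys ^+ p - 1).
Proof.
rewrite /Ys; have [r [s ->]] := truncexpX w.
have [r' er] := truncexp_split2 (w ^+ p).
have -> : \sum_(k < p) C k * w ^+ (k * p) = truncexp (w ^+ p).
  by apply: eq_bigr => k _; rewrite -exprM mulnC.
rewrite er w_p.
set f := (X in dv _ _ X).
have -> : f = p%:R ^+ 2 * (w * (w * r' + r - s)) by rewrite /f; ring.
apply: dv_mul; last by apply: dv_mulr; apply: dv_w.
by rewrite mulnC; apply: dv_exp; apply: dv_p.
Qed.

(** Frobenius gives the truncated exponential of [y] modulo [p] for the [p ^ e]-th power; its [p]-th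
    power is then known modulo [p ^ 2]. The term [p%:R * y] is the first error that the tail has to
    remove. *)
Lemma dv_truncexp_x_pow : dv u (M + p * h) (truncexp x ^+ q - (Ys + p%:R * y)).
Proof.
have [r er] := frobenius_mod p_pr e p (fun k => C k * x ^+ k).
have eC k m : (k < p)%N -> C k ^+ (p ^ m) = C k.
  by move=> kp; elim: m => [|m IH]; rewrite ?expr1 // expnSr exprM IH Cp.
have {er} : truncexp x ^+ (p ^ e) = truncexp y + p%:R * r.
  rewrite [LHS]er; congr (_ + _); apply: eq_bigr => k _.
  by rewrite exprMn eC // /y -!exprM mulnC.
rewrite {1}/q expnSr exprM => ->.
have [r1 ->] := expp_mod_sqr p_pr (truncexp y) r.
have [r2 [s ->]] := truncexpX y.
have -> : \sum_(k < p) C k * y ^+ (k * p) = Ys.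
  by apply: eq_bigr => k _; rewrite w_y -exprM mulnC.
rewrite -w_y; set f := (X in dv _ _ X).
have -> : f = p%:R ^+ 2 * (r1 + y * r2) + p%:R * w * s by rewrite /f; ring.
apply: dv_add; apply: dv_mulr; last by apply: dv_mul; [apply: dv_p|apply: dv_w].
by apply: dv_le (dv_exp 2 dv_p); lia.
Qed.

Lemma lead_Ystar : lead rho u (p * h) (Ys - 1) (rho a ^+ q).
Proof.
have [r er] := truncexp_split2 w.
apply: (lead_congr (unif_red U) (f := w)).
  by rewrite w_val; exists (a ^+ q); [rewrite mulrC | rewrite rmorphXn].
rewrite /Ys er; have -> : 1 + w + w ^+ 2 * r - 1 - w = w ^+ 2 * r by ring.
by apply: dv_mulr; apply: dv_le (dv_exp 2 dv_w); lia.
Qed.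

(** The prefix is the full truncated exponential plus [t], where [t] begins with [- C i * x ^+ i].
    The leading form is that of [t ^+ q], so the missing term is the next digit. *)
Lemma lead_prefix (i : nat) : (1 < i < p)%N ->
  lead rho u (i * (p * h)) ((\sum_(k < i) C k * x ^+ k) ^+ q - Ys)
    (- rho (C i * a ^+ i) ^+ q).
Proof.
move=> /andP[i1 ip].
pose t := - \sum_(i <= k < p) C k * x ^+ k.
have eb : \sum_(k < i) C k * x ^+ k = truncexp x + t.
  rewrite /truncexp /t -!(big_mkord xpredT (fun k => C k * x ^+ k)).
  by rewrite (@big_cat_nat _ _ _ i 0 p) ?(ltnW ip) //= addrK.
have lt : lead rho u (p ^ l * i) t (- rho (C i * a ^+ i)).
  apply: lead_opp; apply: (lead_congr (unif_red U) (f := C i * x ^+ i)).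
    exists (C i * a ^+ i) => //; rewrite /x exprMn exprM; ring.
  rewrite big_ltn // addrC addKr big_nat_cond; apply: dv_sum => k /andP[/andP[lk _] _].
  apply: dv_mull; apply: dv_le (dv_exp k dv_x); rewrite -ltnS ltnS.
  by rewrite ltn_mul2l expn_gt0 prime_gt0.
have [r [r' er]] := expand_power p_pr e (truncexp x) t.
rewrite -/q in er; rewrite eb er.
apply: (lead_congr (unif_red U) (f := t ^+ q)).
  have -> : (i * (p * h) = p ^ l * i * q)%N by rewrite mulnAC qlE mulnC.
  have <- : (- rho (C i * a ^+ i)) ^+ q = - rho (C i * a ^+ i) ^+ q.
    by rewrite exprNn -signr_odd odd_expp expr1 mulN1r.
  exact: lead_exp.
set B := _ ^+ p.-1; set tt := t ^+ (p ^ e).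
have dt : dv u (h * i) tt.
  have -> : (h * i = p ^ l * i * p ^ e)%N by rewrite hE; lia.
  by apply: dv_exp; apply: lead_dv lt.
set f := (X in dv _ _ X).
have -> : f = (truncexp x ^+ q - (Ys + p%:R * y)) + p%:R * y
     + p%:R * tt * (B + tt * r) + p%:R ^+ 2 * r' by rewrite /f; ring.
(* This is where [i <= p.-1] matters: [t ^+ q] has valuation at most [M] and still dominates
   [p%:R * y], of valuation at least [M + h]. *)
have le1 : (i * (p * h) <= M)%N by rewrite mulnC /M leq_mul2l; lia.
apply: dv_add; [apply: dv_add; [apply: dv_add|]|].
- by apply: dv_le dv_truncexp_x_pow; nia.
- by apply: dv_le (dv_mul dv_p dv_y); lia.
- by apply: dv_mulr; apply: dv_le (dv_mul dv_p dt); nia.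
- by apply: dv_mulr; apply: dv_le (dv_exp 2 dv_p); nia.
Qed.

(** Divided by [M] this is [1/(p^(n-2)(p-1)) - 1/p^(n+j)]. For [j < l] the truncated subtractions
    are genuine. *)
Definition tail_val (j : nat) := (p ^ l.+1 - p ^ (l.-1 - j) * p.-1)%N.

Definition long_prefix (j : nat) := truncexp x + \sum_(m < j) a * u ^+ tail_val m.

Lemma dv_expr1 c m f : dv u c (f - 1) -> dv u c (f ^+ m - 1).
Proof. by move=> H; rewrite subrX1; apply: dv_mulr. Qed.

(** In valuations, [p/(p-1) - 1/p^(j+1)]: the errors stay below [M + p * h], so this one precision
    serves all tail terms. *)
Lemma tail_val_mulq j : (j < l)%N -> (tail_val j * q = M + p * h - p ^ e * p ^ (l - j) * p.-1)%N.
Proof.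
move=> jl; rewrite /tail_val mulnBl /q /M /h.
have -> : (l - j = (l.-1 - j).+1)%N by lia.
rewrite !expnS expnD; have p0 : (p = p.-1.+1)%N by lia.
congr (_ - _)%N; last by lia.
by rewrite {1 3 5}p0; lia.
Qed.

Lemma tail_bound j : (j < l)%N -> (p ^ (l.-1 - j) * p * p.-1 <= p ^ l * p.-1)%N.
Proof.
move=> jl; rewrite leq_mul2r -expnSr leq_pexp2l ?orbT ?prime_gt0 //.
by case: l jl => // l' _; rewrite ltnS leq_subr.
Qed.

Lemma tail_val_mulpe j : (j < l)%N -> (tail_val j * p ^ e = p * h - p ^ e * p ^ (l.-1 - j) * p.-1)%N.
Proof.
by move=> jl; rewrite /tail_val mulnBl /h !expnS expnD; lia.
Qed.

Lemma tail_val_ge j : (j < l)%N -> (p ^ l <= tail_val j)%N.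
Proof. by move=> jl; rewrite /tail_val expnS; have := tail_bound jl; nia. Qed.

Lemma long_prefix1 j : (j <= l)%N -> dv u (p ^ l) (long_prefix j - 1).
Proof.
move=> jl; rewrite /long_prefix; have [r ->] := truncexp_split2 x.
have -> (v : A) : 1 + x + x ^+ 2 * r + v - 1 = x * (1 + x * r) + v by ring.
apply: dv_add; first by apply: dv_mulr; apply: dv_x.
apply: dv_sum => m _; apply: dv_mull; apply: dv_le (dv_base _ _).
by apply: tail_val_ge; apply: leq_trans jl.
Qed.

(* Adding a tail term [t] changes the [q]-th power by [t ^+ q] plus the
   [p]-multiple [p * t ^+ (p ^ e)]: the former cancels the current error term
   and the latter is the next one. *)
Lemma dv_long_prefix j : (j < l)%N ->
  dv u (M + p * h) (long_prefix j ^+ q - (Ys + al * u ^+ (tail_val j * q))).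
Proof.
elim: j => [|j IH] jl.
  rewrite /long_prefix big_ord0 addr0.
  (* Both sides have exponent [M + h]: the error left by the truncated exponential is the starting
     error of the tail. *)
  have -> : al * u ^+ (tail_val 0 * q) = p%:R * y; last exact: dv_truncexp_x_pow.
  rewrite y_val -uM mulrCA -exprD; congr (_ * _ ^+ _).
  rewrite tail_val_mulq // subn0 -hE /M; nia.
have {IH} := IH (ltnW jl); set b := long_prefix j => dvb.
have -> : long_prefix j.+1 = b + a * u ^+ tail_val j.
  by rewrite /long_prefix big_ord_recr /= addrA.
have [r [r' ->]] := expand_power p_pr e b (a * u ^+ tail_val j).
rewrite -/q.
have -> : (a * u ^+ tail_val j) ^+ q = - al * u ^+ (tail_val j * q).
  by rewrite exprMn a_expq -exprM.
have -> : (a * u ^+ tail_val j) ^+ (p ^ e) = al * u ^+ (tail_val j * p ^ e).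
  by rewrite exprMn -exprM.
set B := (b ^+ _) ^+ p.-1.
have eS : al * u ^+ (tail_val j.+1 * q) = p%:R * (al * u ^+ (tail_val j * p ^ e)).
  rewrite -uM mulrCA -exprD; congr (_ * _ ^+ _).
  rewrite tail_val_mulq // tail_val_mulpe ?(ltnW jl) //.
  have -> : (l - j.+1 = l.-1 - j)%N by lia.
  rewrite addnBA //; have := tail_bound (ltnW jl).
  by rewrite hE; nia.
rewrite eS; set T := u ^+ (tail_val j * p ^ e); set f := (X in dv _ _ X).
have -> : f = (b ^+ q - (Ys + al * u ^+ (tail_val j * q)))
   + p%:R * al * ((B - 1) * T) + p%:R * (T * T) * (al ^+ 2 * r) + p%:R ^+ 2 * r'.
  by rewrite /f; ring.
(* Replacing [B] by 1 in the cross term costs nothing: [T] has valuation at least [p * h - h], and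
   [B - 1] supplies the missing [h]. *)
have dB : dv u h (B - 1).
  apply: dv_expr1.
  have [s es] := frobenius_mod2 p_pr e 1 (b - 1).
  have -> : b ^+ (p ^ e) - 1 = (b - 1) ^+ (p ^ e) + p%:R * s.
    move: es; rewrite expr1n [1 + (b - 1)]addrC subrK => ->; ring.
  apply: dv_add.
    rewrite hE mulnC; apply: dv_exp; apply: long_prefix1; lia.
  by apply: dv_mulr; apply: dv_le dv_p; nia.
have dT : dv u (p * h - h) T.
  apply: dv_le (dv_base _ _); rewrite tail_val_mulpe ?(ltnW jl) // leq_sub2l //.
  by have := tail_bound (ltnW jl); rewrite hE; nia.
have dBT : dv u (p * h) ((B - 1) * T).
  by apply: dv_le (dv_mul dB dT); nia.
have dTT : dv u (p * h) (T * T).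
  by apply: dv_le (dv_mul dT dT); nia.
apply: dv_add; [apply: dv_add; [apply: dv_add|]|] => //.
- by apply: dv_mul => //; apply: dv_mulr; apply: dv_p.
- by apply: dv_mulr; apply: dv_mul => //; apply: dv_p.
- by apply: dv_mulr; apply: dv_le (dv_exp 2 dv_p); nia.
Qed.

Lemma lead_long_prefix j : (j < l)%N ->
  lead rho u (tail_val j * q) (long_prefix j ^+ q - Ys) (- rho a ^+ q).
Proof.
move=> jl; apply: (lead_congr (unif_red U) (f := al * u ^+ (tail_val j * q))).
  exists al; first by rewrite mulrC.
  by rewrite -rmorphXn a_expq rmorphN opprK.
have dd := dv_long_prefix jl.
rewrite -addrA -opprD; apply: dv_le dd.
rewrite tail_val_mulq //.
have : (0 < p ^ e * p ^ (l - j) * p.-1)%N by rewrite !muln_gt0 !expn_gt0 prime_gt0 //; lia.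
by nia.
Qed.

(** Scaling the variable by [u ^+ s] gives all points on a side of slope [s] the same valuation, so
    one leading form captures the whole side. *)
Definition shifted_phi (b : A) (s : nat) : {poly A} :=
  \sum_(i < p) (b%:P + (u ^+ s)%:P * 'X) ^+ (q * i).

Let V := uniformizer_poly U.

Lemma vM : u%:P ^+ M = p%:R :> {poly A}.
Proof. by rewrite -rmorphXn uM /= polyC_natr. Qed.

Lemma phi_mul b s :
  ((b%:P + (u ^+ s)%:P * 'X) ^+ q - 1) * shifted_phi b s
    = ((b%:P + (u ^+ s)%:P * 'X) ^+ q) ^+ p - 1.
Proof. by rewrite [RHS]subrX1; congr (_ * _); apply: eq_bigr => i _; rewrite exprM. Qed.

Lemma shift_pow b s : exists r r' : {poly A},
  (b%:P + (u ^+ s)%:P * 'X) ^+ q = (b ^+ q)%:P + u%:P ^+ (s * q) * 'X^q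
    + u%:P ^+ (M + s * p ^ e) * r + u%:P ^+ (M * 2) * r'.
Proof.
have [r [r' er]] := expand_power p_pr e b%:P ((u ^+ s)%:P * 'X).
pose T := u%:P ^+ s ^+ (p ^ e); pose Z : {poly A} := 'X ^+ (p ^ e).
exists (b%:P ^+ (p ^ e) ^+ p.-1 * Z + T * Z ^+ 2 * r), r'.
rewrite -/q in er; rewrite er !exprMn !rmorphXn /= exprD [u%:P ^+ (M * 2)]exprM vM.
rewrite [u%:P ^+ (s * _)]exprM [u%:P ^+ (s * _)]exprM -/T -/Z.
set B := _ ^+ p.-1; ring.
Qed.

Lemma lead_phi (b : A) (s : nat) (om : K) :
  (p * h < s * q)%N -> (s * p ^ e < p * h)%N ->
  lead rho u (s * q) (b ^+ q - Ys) (- om) ->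
  lead (map_poly rho) u%:P (M + s * q - p * h) (shifted_phi b s)
    ((rho a ^+ q)^-1 *: ('X^q - om%:P)).
Proof.
move=> s_gt s_lt lb.
have sq_lt : (s * q < M + p * h)%N.
  by rewrite qE /M; move: s_lt; set sp := (s * p ^ e)%N; nia.
have lt2 : (s * q < M + s * p ^ e)%N by rewrite qE /M; nia.
have VR := unif_red V.
have lD : lead (map_poly rho) u%:P (s * q)
    ((b%:P + (u ^+ s)%:P * 'X) ^+ q - Ys%:P) ('X^q - om%:P).
  have lX : lead (map_poly rho) u%:P (s * q) (u%:P ^+ (s * q) * 'X^q) 'X^q.
    by exists 'X^q => //=; rewrite map_polyXn.
  have := lead_add (lead_polyC lb) lX.
  rewrite polyCN [- _ + _]addrC => lbX; apply: (lead_congr VR lbX).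
  have [r [r' ->]] := shift_pow b s; set f := (X in dv _ _ X).
  have -> : f = u%:P ^+ (M + s * p ^ e) * r + u%:P ^+ (M * 2) * r'.
    by rewrite /f polyCB; ring.
  by apply: dv_add; apply: dv_mulr; apply: dv_le (dv_base _ _); nia.
set Y := (_ ^+ q) in lD.
have lY1 : lead (map_poly rho) u%:P (p * h) (Y - 1) (rho a ^+ q)%:P.
  apply: (lead_congr VR (lead_polyC lead_Ystar)).
  have -> : Y - 1 - (Ys - 1)%:P = Y - Ys%:P by rewrite polyCB; ring.
  exact: dv_le s_gt (lead_dv lD).
have rY : rho Ys = 1.
  have [g eg _] := lead_Ystar.
  have -> : Ys = 1 + u ^+ (p * h) * g by rewrite -eg; ring.
  rewrite rmorphD rmorph1 rmorphM rmorphXn (unif_red U) expr0n.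
  by rewrite (_ : (p * h == 0)%N = false) ?mul0r ?addr0 //; nia.
have lYp : lead (map_poly rho) u%:P (M + s * q) (Y ^+ p - 1) ('X^q - om%:P).
  have [r er] := binomial_first_order p_pr Ys%:P (Y - Ys%:P).
  rewrite [Ys%:P + _]addrC subrK in er; rewrite er.
  have l1 : lead (map_poly rho) u%:P (M + s * q)
      (p%:R * Ys%:P ^+ p.-1 * (Y - Ys%:P)) ('X^q - om%:P).
    rewrite -['X^q - _]mul1r; apply: lead_mul => //.
    exists (Ys%:P ^+ p.-1); first by rewrite vM.
    by rewrite rmorphXn /= map_polyC /= rY expr1n.
  apply: (lead_congr VR l1); set D := Y - Ys%:P; set Z := _ ^+ p.-1.
  have -> : Ys%:P ^+ p + p%:R * Z * D + p%:R * D ^+ 2 * r + D ^+ p - 1 - p%:R * Z * D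
     = (Ys ^+ p - 1)%:P + p%:R * D ^+ 2 * r + D ^+ p.
    by rewrite polyCB rmorphXn /=; ring.
  have dD : dv u%:P (s * q) D by apply: lead_dv lD.
  apply: dv_add; [apply: dv_add|].
  - by apply: dv_le (dv_polyC Ystar_pow); lia.
  - apply: dv_mulr; rewrite -vM; apply: dv_le (dv_mul (dv_base _ _) (dv_exp 2 dD)); lia.
  - apply: dv_le (dv_exp p dD); rewrite /M; move: s_gt; set sq := (s * q)%N; nia.
have a0 : rho a ^+ q != 0 by rewrite expf_neq0 // rho_a_neq0.
apply: (lead_divide V (F := (rho a ^+ q)%:P) (c := (p * h)%N) (f := Y - 1)) => //.
  by rewrite polyC_eq0.
rewrite phi_mul -/Y mul_polyC scalerA divff // scale1r subnKC //; lia.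
Qed.

(** At [b = 1] the terms [p (Y - 1)] and [(Y - 1)^p] have equal valuation [M + p * h], so both
    survive and ['X^q + 'X^(q * p)] is divided by ['X^q]. *)
Lemma lead_phi1 :
  lead (map_poly rho) u%:P M (shifted_phi 1 (p ^ l)) ('X^(q * p.-1) + 1).
Proof.
have VR := unif_red V.
have lD : lead (map_poly rho) u%:P (p * h)
    (((1 : A)%:P + (u ^+ (p ^ l))%:P * 'X) ^+ q - 1) 'X^q.
  have lX : lead (map_poly rho) u%:P (p * h) (u%:P ^+ (p * h) * 'X^q) 'X^q.
    by exists 'X^q => //=; rewrite map_polyXn.
  apply: (lead_congr VR lX).
  have [r [r' ->]] := shift_pow 1 (p ^ l); set f := (X in dv _ _ X).
  have -> : f = u%:P ^+ (M + p ^ l * p ^ e) * r + u%:P ^+ (M * 2) * r'.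
    by rewrite /f expr1n qlE polyC1; ring.
  by apply: dv_add; apply: dv_mulr; apply: dv_le (dv_base _ _); nia.
set Y := (_ ^+ q) in lD.
have pM : (M + p * h = p * h * p)%N by rewrite /M; nia.
apply: (lead_divide V (F := 'X^q) (c := (p * h)%N) (f := Y - 1)) => //.
  by rewrite monic_neq0 // monicXn.
rewrite phi_mul -/Y.
have [r er] := binomial_first_order p_pr 1 (Y - 1).
rewrite [1 + _]addrC subrK !expr1n mulr1 in er; rewrite er.
have l1 : lead (map_poly rho) u%:P (M + p * h) (p%:R * (Y - 1)) 'X^q.
  rewrite -['X^q]mul1r; apply: lead_mul => //.
  by exists 1; rewrite ?vM ?mulr1 ?rmorph1.
have l2 := lead_exp p lD; rewrite -pM -exprM in l2.
have -> : 'X^q * ('X^(q * p.-1) + 1) = 'X^q + 'X^(q * p) :> {poly K}.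
  by rewrite mulrDr mulr1 -exprD -mulnS prednK ?prime_gt0 // addrC.
rewrite [(p * h + M)%N]addnC; apply: (lead_congr VR (lead_add l1 l2)).
set D := Y - 1.
have -> : 1 + p%:R * D + p%:R * D ^+ 2 * r + D ^+ p - 1 - (p%:R * D + D ^+ p)
   = p%:R * D ^+ 2 * r by ring.
apply: dv_mulr; rewrite -vM; apply: dv_le (dv_mul (dv_base _ _) (dv_exp 2 (lead_dv lD))).
nia.
Qed.
End ClusterOfRoots.

(** * The ramified extension W[X]/(X^M - p) *)

Section Eisenstein.
Variables (p M : nat) (M_gt0 : (0 < M)%N) (K : idomainType) (W : comNzRingType).
Variable red : {rmorphism W -> K}.
Hypothesis red_ker : forall w : W, red w = 0 <-> exists v, w = p%:R * v.
Hypothesis p_reg : forall w : W, p%:R * w = 0 -> w = 0.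

Let th : {poly W} := 'X^M - (p%:R)%:P.

(** The residue map is the constant coefficient modulo [p], well defined because that of [th] is
    [-p]. If ['X * f = th * S], constant coefficients show that ['X] divides [S] and cancels, whence
    regularity. A constant divisible by [p] is divisible by [u] since [p = u^M]. *)
Lemma eisenstein_extension : exists (A : comNzRingType) (rho : {rmorphism A -> K})
    (ev : {rmorphism {poly W} -> A}),
  [/\ uniformizer rho (ev 'X), ev 'X ^+ M = p%:R,
      forall a, exists P, a = ev P, forall P, ev P = 0 -> exists S, P = th * S
    & forall P, rho (ev P) = red P`_0].
Proof.
have thM : th \is monic by apply: monicXnsubC.
have mkth : mk_monic th = th.
  by rewrite /mk_monic size_XnsubC // ltnS M_gt0 thM.
have redp : red p%:R = 0 by apply/red_ker; exists 1; rewrite mulr1.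
have th0 : red th`_0 = 0.
  by rewrite coefB coefXn coefC /= rmorphB redp subr0 eq_sym eqn0Ngt M_gt0 rmorph0.
have red_mod P : red (Pdiv.CommonRing.rmodp P (mk_monic th))`_0 = red P`_0.
  rewrite mkth [in RHS](Pdiv.RingMonic.rdivp_eq thM P) coefD rmorphD.
  by rewrite coef0M rmorphM th0 mulr0 add0r.
pose A := {poly %/ th}.
pose r (a : A) := red (a : {poly W})`_0.
have rA : zmod_morphism r by move=> a b; rewrite /r /= coefB rmorphB.
have rM : monoid_morphism r.
  split; first by rewrite /r /= coefC eqxx rmorph1.
  by move=> a b; rewrite /r poly_of_qpolyM red_mod coef0M rmorphM.
pose rho : {rmorphism A -> K} := HB.pack r
  (GRing.isZmodMorphism.Build A K r rA) (GRing.isMonoidMorphism.Build A K r rM).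
pose ev : {rmorphism {poly W} -> A} := in_qpoly th.
have evK (a : A) : ev (a : {poly W}) = a.
  by apply: val_inj; apply: in_qpoly_small; apply: size_mk_monic.
have ev_ker P : ev P = 0 -> exists S, P = th * S.
  move=> /(congr1 val) /=; rewrite mkth => e0.
  exists (Pdiv.CommonRing.rdivp P th).
  by rewrite [LHS](Pdiv.RingMonic.rdivp_eq thM P) e0 addr0 mulrC.
have rho_ev P : rho (ev P) = red P`_0 by apply: red_mod.
have ev_th : ev th = 0.
  apply: val_inj; rewrite /= mkth; exact: (Pdiv.RingMonic.rmodpp thM).
have uM : ev 'X ^+ M = p%:R.
  rewrite -rmorphXn /= -(rmorph_nat ev p); apply/eqP; rewrite -subr_eq0 -rmorphB /=.
  by rewrite -polyC_natr ev_th.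
exists A, rho, ev; split=> //; last first.
  by move=> a; exists (a : {poly W}); rewrite evK.
split.
- move=> f; rewrite -(evK f) -rmorphM => /ev_ker [S eS].
  have S0 : S`_0 = 0.
    apply: p_reg; have := congr1 (fun Q : {poly W} => Q`_0) eS.
    rewrite coefXM /= coef0M coefB coefXn coefC /= eq_sym eqn0Ngt M_gt0 /= sub0r mulNr.
    by move/esym/eqP; rewrite oppr_eq0 => /eqP.
  have [S' eS'] : exists S', S = S' * 'X.
    elim/poly_ind: S S0 {eS} => [|S' c _]; first by exists 0; rewrite mul0r.
    by rewrite coefD coefMX coefC add0r /= => ->; exists S'; rewrite addr0.
  have -> : (f : {poly W}) = th * S'.
    by apply: (monic_lreg (monicX W)); rewrite eS eS' mulrA mulrC.
  by rewrite rmorphM ev_th mul0r.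
- by rewrite rho_ev coefX rmorph0.
- move=> f; rewrite -(evK f) rho_ev; move: (f : {poly W}) => F.
  elim/poly_ind: F => [|F c _]; first by exists 0; rewrite rmorph0 mulr0.
  rewrite coefD coefMX coefC add0r /= => /red_ker[w ->].
  exists (ev F + ev 'X ^+ M.-1 * ev w%:P).
  rewrite mulrDr mulrA -exprS prednK // uM rmorphD !rmorphM mulrC; congr (_ + _).
  by rewrite !rmorph_nat.
Qed.

End Eisenstein.

(** * Teichmüller expansions *)

Lemma pbP (P : Prop) : reflect P (pb P).
Proof. by rewrite /pb; case: excluded_middle_informative => ?; constructor. Qed.

Lemma nat_least (T : nat -> Prop) :
  (exists j, T j) -> exists j, T j /\ forall i, T i -> (j <= i)%N.
Proof.
move=> [j Tj]; have exT : exists j, pb (T j) by exists j; apply/pbP.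
exists (ex_minn exT); case: ex_minnP => m /pbP Tm min; split=> // i Ti.
by apply: min; apply/pbP.
Qed.

Lemma functional_choice (S T : Type) (R : S -> T -> Prop) :
  (forall x, exists y, R x y) -> exists f, forall x, R x (f x).
Proof.
move=> H; exists (fun x => proj1_sig (constructive_indefinite_description _ (H x))).
by move=> x; exact: (proj2_sig (constructive_indefinite_description _ (H x))).
Qed.

Lemma well_ordered_sub (S T : rat -> Prop) :
  (forall x, T x -> S x) -> well_ordered S -> well_ordered T.
Proof. by move=> TS wS X XT; apply: wS => x /XT /TS. Qed.

Lemma well_orderedU (S T : rat -> Prop) :
  well_ordered S -> well_ordered T -> well_ordered (fun x => S x \/ T x).
Proof.
move=> wS wT X XST [x0 Xx0].
have [[xs Xs]|nS] := excluded_middle_informative (exists x, X x /\ S x).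
  have [ms [[Xms _] ms_min]] :=
    wS (fun x => X x /\ S x) (fun x => @proj2 _ _) (ex_intro _ xs Xs).
  have [[xt Xt]|nT] := excluded_middle_informative (exists x, X x /\ T x).
    have [mt [[Xmt _] mt_min]] :=
    wT (fun x => X x /\ T x) (fun x => @proj2 _ _) (ex_intro _ xt Xt).
    exists (Num.min ms mt); split; first by rewrite minElt; case: ifP.
    move=> y Xy; rewrite ge_min; case: (XST y Xy) => Hy; apply/orP.
      by left; apply: ms_min.
    by right; apply: mt_min.
  exists ms; split=> // y Xy; case: (XST y Xy) => Hy; first by apply: ms_min.
  by case: nT; exists y.
apply: wT; last by exists x0.
by move=> x Xx; case: (XST x Xx) => // Sx; case: nS; exists x.
Qed.

(** * Functions supported on the nonnegative multiples of 1/M *)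

Section Grid.
Variables (M : nat) (M_gt0 : (0 < M)%N).

(* [grid c] is supported on the [j / M] with [j : nat]; [Num.trunc] is [0] on
   negative rationals. *)
Definition grid (T : nmodType) (c : nat -> T) (y : rat) : T :=
  if (Num.trunc (y * M%:R))%:R == y * M%:R then c (Num.trunc (y * M%:R)) else 0.

Let M_neq0 : M%:R != 0 :> rat. Proof. by rewrite pnatr_eq0 -lt0n. Qed.

Lemma gridE (T : nmodType) (c : nat -> T) j : grid c (j%:R / M%:R) = c j.
Proof. by rewrite /grid divfK // natrK eqxx. Qed.

(** The second case quantifies over all [T] and [c], so that the constant function 1 refutes it at
    any grid point. *)
Lemma gridP (y : rat) :
  (exists j : nat, y = j%:R / M%:R) \/
  (forall (T : nmodType) (c : nat -> T), grid c y = 0).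
Proof.
have [e|ne] := eqVneq ((Num.trunc (y * M%:R))%:R) (y * M%:R).
  by left; exists (Num.trunc (y * M%:R)); rewrite e mulfK.
by right=> T c; rewrite /grid (negPf ne).
Qed.

Lemma grid_well_ordered (T : nmodType) (c : nat -> T) :
  well_ordered (fun y => grid c y != 0).
Proof.
move=> X XS [x0 Xx0].
have XG x : X x -> exists j : nat, x = j%:R / M%:R.
  move=> Xx; have := XS x Xx; case: (gridP x) => // -> ; by rewrite eqxx.
have [j0 ej0] := XG _ Xx0.
have [|j [Xj jmin]] := @nat_least (fun j => X (j%:R / M%:R)).
  by exists j0; rewrite -ej0.
exists (j%:R / M%:R); split=> // y Xy; have [i ei] := XG _ Xy.
by rewrite ei ler_pM2r ?invr_gt0 ?ltr0n // ler_nat jmin // -ei.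
Qed.

End Grid.

(** * Teichmüller representatives *)

Section Witt.
Variables (p : nat) (p_pr : prime p) (p_gt2 : (2 < p)%N).
Variables (k : closedFieldType) (Wk : comUnitRingType).
Variables (red : {rmorphism Wk -> k}) (teich : k -> Wk).
Hypothesis Fp : is_Fpbar p k.
Hypothesis WW : is_Witt p red teich.

Lemma witt_ker w : red w = 0 <-> exists u, w = p%:R * u.
Proof. by case: WW => _ []. Qed.

Lemma witt_reg (w : Wk) : p%:R * w = 0 -> w = 0.
Proof. by case: WW => _ [_ [H _]]; apply: H. Qed.

Lemma witt_sep (w : Wk) : (forall N : nat, exists u, w = p%:R ^+ N * u) -> w = 0.
Proof. by case: WW => _ [_ [_ [H _]]]; apply: H. Qed.

Lemma teichK c : red (teich c) = c.
Proof. by case: WW => _ [_ [_ [_ [_ []]]]]. Qed.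

Lemma teichM a b : teich (a * b) = teich a * teich b.
Proof. by case: WW => _ [_ [_ [_ [_ []]]]]. Qed.

Lemma red_p : red p%:R = 0.
Proof. by apply/witt_ker; exists 1; rewrite mulr1. Qed.

(** A difference divisible by [p^(N+1)] equals the difference of the [p]-th powers, hence is
    divisible by [p^(N+2)]; separatedness concludes. *)
Lemma fixed_frobenius_unique (a b : Wk) :
  a ^+ p = a -> b ^+ p = b -> red a = red b -> a = b.
Proof.
move=> ap bp ab; apply/eqP; rewrite -subr_eq0; apply/eqP/witt_sep.
have H N : exists u, a - b = p%:R ^+ N.+1 * u.
  elim: N => [|N [u eu]].
    by rewrite expr1; apply/witt_ker; rewrite rmorphB ab subrr.
  have ea : a = b + p%:R ^+ N.+1 * u by rewrite -eu addrC subrK.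
  have [r er] := binomial_first_order p_pr b (p%:R ^+ N.+1 * u).
  rewrite -ea ap bp in er; rewrite {1}er.
  have -> : (p%:R ^+ N.+1 * u) ^+ p = p%:R ^+ N.+2 * (p%:R ^+ (N.+1 * p - N.+2) * u ^+ p).
    by rewrite mulrA -exprD subnKC -?exprM ?exprMn -?exprM //; nia.
  set s := p%:R ^+ (_ - _) * _; set B := b ^+ p.-1; pose q : Wk := p%:R ^+ N.
  exists (B * u + p%:R ^+ 1 * q * u ^+ 2 * r + s).
  by rewrite !exprS -/q; ring.
by case=> [|N //]; exists (a - b); rewrite expr0 mul1r.
Qed.

Lemma teichXS c m : teich (c ^+ m.+1) = teich c ^+ m.+1.
Proof. by elim: m => [|m IH]; rewrite ?expr1 // exprS teichM IH -exprS. Qed.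

Lemma teich_fixed c : c ^+ p = c -> teich c ^+ p = teich c.
Proof. by move=> e; rewrite -{2}e -(prednK (prime_gt0 p_pr)) -teichXS. Qed.

(** This supplies the values of [teich] at 0, 1 and -1 from its multiplicativity and the section
    property. *)
Lemma teich_unique c w : w ^+ p = w -> red w = c -> teich c = w.
Proof.
move=> wp rw; apply: fixed_frobenius_unique => //; last by rewrite teichK.
by apply: teich_fixed; rewrite -rw -rmorphXn wp.
Qed.

Lemma teich0 : teich 0 = 0.
Proof.
by apply: teich_unique; rewrite ?rmorph0 // expr0n; case: p p_pr.
Qed.

Lemma teich1 : teich 1 = 1.
Proof. by apply: teich_unique; rewrite ?rmorph1 ?expr1n. Qed.

Lemma odd_p : odd p.
Proof. by case: (even_prime p_pr) p_gt2 => [->|->]. Qed.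

Lemma teichN1 : teich (-1) = -1.
Proof. by apply: teich_unique; rewrite ?rmorphN ?rmorph1 // -signr_odd odd_p expr1. Qed.

Lemma teichV c : c != 0 -> teich c^-1 = (teich c)^-1.
Proof.
move=> c0; have e : teich c * teich c^-1 = 1 by rewrite -teichM divff ?teich1.
have uc : teich c \is a GRing.unit by apply/unitrPr; exists (teich c^-1).
by apply: (mulrI uc); rewrite e divrr.
Qed.

Lemma teichX c m : teich (c ^+ m) = teich c ^+ m.
Proof. by case: m => [|m]; [rewrite !expr0 teich1 | exact: teichXS]. Qed.

Lemma fact_frobenius m : (m`!%:R^-1 : k) ^+ p = m`!%:R^-1.
Proof.
case: Fp => pch _; rewrite exprVn; congr (_^-1).
by rewrite -(pFrobenius_autE pch) pFrobenius_aut_nat.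
Qed.

Lemma natr_fact_neq0 m : (m < p)%N -> (m`!%:R : k) != 0.
Proof.
case: Fp => pch _ mp; rewrite -(dvdn_pcharf pch).
elim: m mp => [|m IH] mp; first by rewrite fact0 dvdn1; case: p p_gt2 => [|[]].
by rewrite factS Euclid_dvdM // negb_or IH ?(ltnW mp) // andbT gtnNdvd.
Qed.

Definition inv_fact m := teich (m`!%:R^-1).

Lemma inv_fact0 : inv_fact 0 = 1.
Proof. by rewrite /inv_fact fact0 invr1 teich1. Qed.

Lemma inv_fact1 : inv_fact 1 = 1.
Proof. by rewrite /inv_fact invr1 teich1. Qed.

Lemma inv_fact_frobenius m : inv_fact m ^+ p = inv_fact m.
Proof. by apply: teich_fixed; apply: fact_frobenius. Qed.

(** [teich] is not additive, so the recurrence of the exponential coefficients holds only modulo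
    [p]. *)
Lemma inv_factS m : (m.+1 < p)%N ->
  exists d, m.+1%:R * inv_fact m.+1 = inv_fact m + p%:R * d.
Proof.
move=> mp; have [d ed] : exists d, m.+1%:R * inv_fact m.+1 - inv_fact m = p%:R * d.
  apply/witt_ker; rewrite rmorphB rmorphM rmorph_nat !teichK.
  have := natr_fact_neq0 mp; rewrite factS natrM mulf_eq0 negb_or => /andP[m0 f0].
  by rewrite invfM mulrA divff // mul1r subrr.
by exists d; rewrite -ed addrC subrK.
Qed.

Lemma mn_equiv_euclid (f g g' : rat -> Wk) :
  mn_equiv p f g -> mn_equiv p f g' -> mn_equiv p g g'.
Proof.
move=> [h [wh eh]] [h' [wh' eh']]; exists (fun y => h' y - h y); split.
  apply: (well_ordered_sub _ (well_orderedU wh wh')) => x.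
  by case: (eqVneq (h x) 0) => [->|]; [rewrite subr0; right | left].
move=> y; have -> : g y - g' y = (f y - g' y) - (f y - g y) by ring.
by rewrite eh eh'; ring.
Qed.
End Witt.

(** * Finite sums as polynomials in p^(1/M) *)

Section Representation.
Variables (M : nat) (M_gt0 : (0 < M)%N) (Wk : comUnitRingType).

Let M_neq0 : M%:R != 0 :> rat. Proof. by rewrite pnatr_eq0 -lt0n. Qed.

(** The relation is on lists, so it follows the list operations [fsadd], [fsmul] and [fsexp]
    literally. *)
Definition rep (g : fsum Wk) (P : {poly Wk}) := exists s : seq (nat * Wk),
  g = [seq (e.1%:R / M%:R, e.2) | e <- s] /\ P = \sum_(e <- s) e.2 *: 'X^(e.1).

Lemma rep_cat g h P Q : rep g P -> rep h Q -> rep (fsadd g h) (P + Q).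
Proof.
move=> [s [-> ->]] [t [-> ->]]; exists (s ++ t).
by rewrite /fsadd map_cat big_cat.
Qed.

Lemma rep0 : rep (fs0 Wk) 0.
Proof. by exists [::]; rewrite big_nil. Qed.

Lemma rep_monomial j c : rep [:: (j%:R / M%:R, c)] (c *: 'X^j).
Proof. by exists [:: (j, c)]; rewrite big_seq1. Qed.

Lemma rep1 : rep (fs1 Wk) 1.
Proof.
have := rep_monomial 0 1; rewrite mul0r scale1r expr0; exact.
Qed.

Lemma rep_scale c g P : rep g P -> rep (fsscale c g) (c *: P).
Proof.
move=> [s [-> ->]]; exists [seq (e.1, c * e.2) | e <- s]; split.
  by rewrite /fsscale -!map_comp.
by rewrite big_map scaler_sumr; apply: eq_bigr => e _; rewrite scalerA.
Qed.

Lemma rep_mul g h P Q : rep g P -> rep h Q -> rep (fsmul g h) (P * Q).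
Proof.
move=> [s [-> ->]] [t [-> ->]].
exists [seq ((e.1 + f.1)%N, e.2 * f.2) | e <- s, f <- t]; split.
  rewrite /fsmul allpairs_mapl allpairs_mapr map_allpairs.
  by apply: eq_allpairs => // e f; rewrite /= natrD mulrDl.
rewrite big_allpairs_dep mulr_suml; apply: eq_bigr => e _.
rewrite mulr_sumr; apply: eq_bigr => f _ /=.
by rewrite exprD -scalerAl -scalerAr scalerA.
Qed.

Lemma rep_exp g P m : rep g P -> rep (fsexp g m) (P ^+ m).
Proof.
by move=> rg; elim: m => [|m IH]; [exact: rep1 | rewrite exprS; apply: rep_mul].
Qed.

Lemma rep_big m (F : nat -> fsum Wk) (P : nat -> {poly Wk}) :
  (forall j, rep (F j) (P j)) -> rep (fsbig m F) (\sum_(j < m) P j).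
Proof.
move=> rF; rewrite /fsbig -(big_mkord xpredT P) /index_iota subn0.
elim: (iota 0 m) => [|j s IH]; first by rewrite big_nil; exact: rep0.
by rewrite big_cons; apply: rep_cat.
Qed.

Lemma fsF_rep g P : rep g P -> forall y, fsF g y = grid M (fun j => P`_j) y.
Proof.
move=> [s [-> ->]] y; rewrite /fsF big_map /=.
case: (gridP M_gt0 y) => [[j ->]|g0].
  rewrite gridE // coef_sum big_mkcond /=; apply: eq_bigr => e _.
  have Mi : injective (fun y : rat => y / M%:R) by apply: mulIf; rewrite invr_eq0.
  rewrite coefZ coefXn (inj_eq Mi) eqr_nat eq_sym.
  by case: ifP; rewrite ?mulr1 ?mulr0.
rewrite g0 big1 // => e /eqP ye.
by have := g0 _ (fun=> 1 : rat); rewrite -ye gridE.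
Qed.

End Representation.

(** * Uniqueness and computation of Teichmüller expansions *)

Section TeichmuellerExpansion.
Variables (p : nat) (p_pr : prime p) (p_gt2 : (2 < p)%N).
Variables (k : closedFieldType) (Wk : comUnitRingType).
Variables (red : {rmorphism Wk -> k}) (teich : k -> Wk).
Hypothesis WW : is_Witt p red teich.

Lemma mn_equiv_sym (f g : rat -> Wk) : mn_equiv p f g -> mn_equiv p g f.
Proof.
move=> fg; apply: mn_equiv_euclid fg _; exists (fun=> 0); split.
  by move=> X XS [x /XS]; rewrite eqxx.
by move=> y; rewrite subrr mulr0 subr0.
Qed.

(** Let [x0] be the least disagreement. Below it [h (y - 1) = p%:R * h y], so a nonzero [h y] would
    give nonzero values at all [y - m], against well-ordered support. Thus [h] vanishes below [x0],
    the difference at [x0] is a multiple of [p], and the digits agree. *)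
Lemma teich_exp_unique f f' alpha alpha' :
  teich_exp teich f alpha -> teich_exp teich f' alpha' ->
  mn_equiv p f f' -> forall x, alpha x = alpha' x.
Proof.
move=> [wf ef] [wf' ef'] [h [wh eh]] x.
have [//|ne] := excluded_middle_informative (alpha x = alpha' x).
pose X y := alpha y <> alpha' y.
have XS y : X y -> f y != 0 \/ f' y != 0.
  move=> Xy; case: (eqVneq (f y) 0) => [fy|]; last by left.
  right; apply/eqP => f'y; apply: Xy.
  by rewrite -(teichK WW (alpha y)) -ef fy -f'y ef' (teichK WW).
have [x0 [Xx0 x0min]] := well_orderedU wf wf' XS (ex_intro _ x ne).
have agree y : y < x0 -> alpha y = alpha' y.
  move=> ylt; have [//|/x0min] := excluded_middle_informative (alpha y = alpha' y).
  by rewrite leNgt ylt.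
have hstep y : y < x0 -> h (y - 1) = p%:R * h y.
  move=> ylt; have := eh y; rewrite ef ef' agree // subrr => /esym/eqP.
  by rewrite subr_eq0 => /eqP.
have hiter y m : y < x0 -> h (y - m%:R) = p%:R ^+ m * h y.
  move=> ylt; elim: m => [|m IH]; first by rewrite subr0 expr0 mul1r.
  rewrite -natr1 opprD addrA hstep ?IH ?exprS ?mulrA //.
  by apply: le_lt_trans ylt; rewrite gerBl ler0n.
have h0 y : y < x0 -> h y = 0.
  move=> ylt; apply/eqP/negP => /negP hy.
  have hm m : h (y - m%:R) != 0.
    rewrite hiter //; elim: m => [|m IH]; first by rewrite expr0 mul1r.
    rewrite exprS -mulrA; apply/eqP => /(witt_reg WW) e0.
    by rewrite e0 eqxx in IH.
  have [||z [[m ez] zmin]] := wh (fun z => exists m : nat, z = y - m%:R).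
  - by move=> z [m ->]; exact: hm.
  - by exists y, 0%N; rewrite subr0.
  have := zmin (y - m.+1%:R); rewrite ez => /(_ (ex_intro _ m.+1 erefl)).
  by rewrite lerBDr addrAC -addrA -natr1 opprD; lra.
case: Xx0; have := eh x0; rewrite h0; last by rewrite gtrBl ltr01.
rewrite ef ef' sub0r => /(congr1 red).
rewrite rmorphB !(teichK WW) rmorphN rmorphM (red_p WW) mul0r oppr0.
by move/eqP; rewrite subr_eq0 => /eqP.
Qed.

Section Expansion.
Variables (g : fsum Wk) (f : rat -> Wk) (alpha : rat -> k).
Hypothesis fa : teich_exp teich f alpha.
Hypothesis fg : mn_equiv p f (fsF g).

Lemma Cx_expansion x : Cx p teich x g = alpha x.
Proof.
rewrite /Cx; set Q := fun c => _.
have [] : Q (epsilon (inhabits 0) Q).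
  by apply: epsilon_spec; exists (alpha x), alpha, f.
move=> al [f' [fa' [fg' <-]]].
apply: (teich_exp_unique fa' fa).
exact: mn_equiv_euclid (mn_equiv_sym fg') (mn_equiv_sym fg).
Qed.

Lemma vp_expansion v : alpha v != 0 -> (forall y, y < v -> alpha y = 0) ->
  vp p teich g = v.
Proof.
move=> av vmin; rewrite /vp; set Q := fun c => _.
have [] : Q (epsilon (inhabits 0) Q).
  by apply: epsilon_spec; exists v, alpha, f.
move: (epsilon _ _) => v' al [f' [fa' [fg' [av' vmin']]]].
have eal : forall x, al x = alpha x.
  apply: (teich_exp_unique fa' fa).
  exact: mn_equiv_euclid (mn_equiv_sym fg') (mn_equiv_sym fg).
case: (ltgtP v' v) => // lt.
  by move: av'; rewrite eal vmin ?eqxx.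
by move: av; rewrite -eal vmin' ?eqxx.
Qed.

Lemma Lnz_expansion : Lnz p g <-> exists x, alpha x != 0.
Proof.
split.
  move=> gnz; have [//|na] := excluded_middle_informative (exists x, alpha x != 0).
  case: gnz; case: fg => h [wh eh]; exists (fun y => - h y); split.
    by apply: (well_ordered_sub _ wh) => x; rewrite oppr_eq0.
  move=> y; case: fa => _ ef; have := eh y; rewrite ef.
  have -> : alpha y = 0 by case: (eqVneq (alpha y) 0) => // ne; case: na; exists y.
  by rewrite (teich0 p_pr p_gt2 WW) => e; rewrite -[fsF g y]opprK -[- fsF g y]sub0r e; ring.
move=> [x ax] g0; move/negP: ax; apply.
have z0 : teich_exp teich (fun=> 0) (fun=> 0).
  split; first by move=> X XS [y /XS]; rewrite eqxx.
  by move=> y; rewrite (teich0 p_pr p_gt2 WW).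
by rewrite (teich_exp_unique fa z0 (mn_equiv_euclid (mn_equiv_sym fg) g0)).
Qed.

End Expansion.

Section Bridge.
Variables (M : nat) (M_gt0 : (0 < M)%N).
Variables (A : comNzRingType) (rho : {rmorphism A -> k}) (ev : {rmorphism {poly Wk} -> A}).
Hypothesis U : uniformizer rho (ev 'X).
Hypothesis ev_surj : forall a, exists P, a = ev P.
Hypothesis ev_ker : forall P, ev P = 0 -> exists S, P = ('X^M - (p%:R)%:P) * S.
Hypothesis rho_ev : forall P, rho (ev P) = red P`_0.

Let u := ev 'X.
Let T (c : k) : A := ev (teich c)%:P.

Lemma rho_T c : rho (T c) = c.
Proof. by rewrite rho_ev coefC eqxx (teichK WW). Qed.

(** Each remainder has the lift of its residue subtracted and is divided by [u]. As [teich 0 = 0], a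
    factor [u ^+ c] merely shifts the digits. *)
Lemma digits (a : A) : exists (alpha : nat -> k) (r : nat -> A),
  [/\ forall L, a = \sum_(j < L) T (alpha j) * u ^+ j + u ^+ L * r L
    & forall c h, a = u ^+ c * h -> (forall j, (j < c)%N -> alpha j = 0) /\ alpha c = rho h].
Proof.
have exn b : exists c, b - T (rho b) = u * c.
  by apply: (unif_ker U); rewrite rmorphB rho_T subrr.
have [nxt nxtP] := functional_choice exn.
pose r j := iter j nxt a.
have rS j : r j = T (rho (r j)) + u * r j.+1.
  by rewrite /r /= -nxtP addrC subrK.
exists (fun j => rho (r j)), r; split.
  elim=> [|L IH]; first by rewrite big_ord0 add0r mul1r.
  rewrite big_ord_recr /= -addrA {1}IH; congr (_ + _).
  by rewrite {1}rS exprSr mulrDr mulrA; congr (_ + _); rewrite mulrC.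
move=> c h ea.
have red0 m b : rho (u ^+ m.+1 * b) = 0 by rewrite rmorphM rmorphXn (unif_red U) expr0n mul0r.
have rj j : (j <= c)%N -> r j = u ^+ (c - j) * h.
  elim: j => [|j IH] jc; first by rewrite subn0.
  have := rS j; rewrite IH ?(ltnW jc) // -(subnSK jc) red0.
  rewrite /T (teich0 p_pr p_gt2 WW) polyC0 rmorph0 add0r exprS -mulrA => e.
  by apply: (unifX_inj U (m := 1)); rewrite expr1 -e.
split=> [j jc|]; first by rewrite rj ?(ltnW jc) // -(subnSK jc) red0.
by rewrite rj // subnn expr0 mul1r.
Qed.

(** At each precision [L] the kernel of [ev] provides a quotient [S] by ['X^M - p]. Its coefficients
    below [L] are determined recursively, [p] being regular, so quotients of different precision
    agree there and a diagonal sequence is the witness. *)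
Lemma expansion_of_digits (P : {poly Wk}) (alpha : nat -> k) (r : nat -> A) :
  (forall L, ev P = \sum_(j < L) T (alpha j) * u ^+ j + u ^+ L * r L) ->
  mn_equiv p (grid M (fun j => teich (alpha j))) (grid M (fun j => P`_j)).
Proof.
move=> H.
have HS L : exists S : {poly Wk}, forall j, (j < L)%N ->
    P`_j - teich (alpha j) = (if (j < M)%N then 0 else S`_(j - M)) - p%:R * S`_j.
  have [Q eQ] := ev_surj (r L).
  have [S eS] : exists S, P - (\sum_(j < L) (teich (alpha j))%:P * 'X^j + 'X^L * Q)
     = ('X^M - (p%:R)%:P) * S.
    apply: ev_ker; rewrite rmorphB rmorphD rmorphM rmorphXn /= rmorph_sum /=.
    rewrite -eQ {1}(H L); apply/eqP; rewrite subr_eq0; apply/eqP; congr (_ + _).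
    by apply: eq_bigr => j _; rewrite rmorphM rmorphXn.
  exists S => j jL; have := congr1 (fun Q : {poly Wk} => Q`_j) eS.
  rewrite mulrBl !coefB coefD coefCM !coefXnM jL addr0 => <-; congr (_ - _).
  rewrite coef_sum (bigD1 (Ordinal jL)) //= coefCM coefXn eqxx mulr1 big1 ?addr0 //.
  move=> i; rewrite -val_eqE /= coefCM coefXn eq_sym => /negPf ->.
  by rewrite mulr0.
have [S SP] := functional_choice HS.
have pinj (a b : Wk) : p%:R * a = p%:R * b -> a = b.
  move=> e; apply/eqP; rewrite -subr_eq0; apply/eqP/(witt_reg WW).
  by rewrite mulrBr e subrr.
have agree j L L' : (j < L)%N -> (j < L')%N -> (S L)`_j = (S L')`_j.
  elim/ltn_ind: j L L' => j IH L L' jL jL'; apply: pinj.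
  have := SP L j jL; rewrite (SP L' j jL').
  case: ltnP => [_|Mj]; first by rewrite !sub0r => /oppr_inj.
  have jMj : (j - M < j)%N by lia.
  by rewrite (IH _ jMj L' L) ?(ltn_trans jMj) // => /addrI /oppr_inj.
(* The sign is due to [SP] having the difference in the opposite order. *)
pose h j := - (S j.+1)`_j.
exists (grid M h); split; first exact: grid_well_ordered.
have M0 : M%:R != 0 :> rat by rewrite pnatr_eq0 -lt0n.
move=> y; case: (gridP M_gt0 y) => [[j ->]|g0].
  rewrite !gridE //; have := SP j.+1 j (ltnSn j).
  have -> : grid M h (j%:R / M%:R - 1) = if (j < M)%N then 0 else h (j - M)%N.
    have e1 : (j%:R / M%:R - 1 : rat) = (j%:R - M%:R) / M%:R by field.
    case: ltnP => [jM|Mj]; last by rewrite e1 -natrB // gridE.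
    case: (gridP M_gt0 (j%:R / M%:R - 1)) => [[i]|-> //].
    rewrite e1 => /(mulIf _) e2; move: e2; rewrite invr_eq0 => /(_ M0) e2.
    have : (j%:R - M%:R : rat) < 0 by rewrite subr_lt0 ltr_nat.
    by rewrite e2 ltrn0.
  rewrite -opprB => e; rewrite -[LHS]opprK e /h.
  case: ltnP => [_|Mj]; first by ring.
  by rewrite (agree (j - M)%N j.+1 (j - M).+1) //; [ring|lia].
rewrite !g0 subrr mulr0 subr0.
case: (gridP M_gt0 (y - 1)) => [[i ei]|-> //].
have ey : y = (i + M)%:R / M%:R by rewrite natrD mulrDl divff // -ei subrK.
by have := g0 _ (fun=> 1 : rat); rewrite ey gridE.
Qed.

(** The factor [u ^+ e] is the [u ^+ (s * j)] that rescaling puts on coefficient [j]. The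
    conclusions say that [x] bounds the valuation from below, with equality exactly when the digit
    [F] there is nonzero. *)
Lemma lead_expansion (g : fsum Wk) (P : {poly Wk}) (V e : nat) (F : k) (x : rat) :
  rep M g P -> lead rho u V (ev P * u ^+ e) F -> x = (V%:R - e%:R) / M%:R ->
  [/\ Cx p teich x g = F, F != 0 -> Lnz p g /\ vp p teich g = x,
      Lnz p g -> x <= vp p teich g & Lnz p g -> F = 0 -> x < vp p teich g].
Proof.
move=> rg lF ex.
have [al [r [alr all]]] := digits (ev P).
pose f := grid M (fun j => teich (al j)); pose alpha := grid M al.
have t0 := teich0 p_pr p_gt2 WW.
have fa : teich_exp teich f alpha.
  split; first exact: grid_well_ordered.
  move=> y; rewrite /f /alpha; case: (gridP M_gt0 y) => [[j ->]|g0].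
    by rewrite !gridE.
  by rewrite !g0 t0.
have fg : mn_equiv p f (fsF g).
  have [h [wh eh]] := expansion_of_digits alr.
  by exists h; split=> // y; rewrite (fsF_rep M_gt0 rg).
have Mp : 0 < M%:R :> rat by rewrite ltr0n.
have M0 : M%:R != 0 :> rat by rewrite gt_eqF.
have [low ax] : (forall y, y < x -> alpha y = 0) /\ alpha x = F.
  case: lF => g1; case: (leqP e V) => [eV|Ve] e1 rg1.
    have e2 : ev P = u ^+ (V - e) * g1.
      by apply: (unifX_inj U (m := e)); rewrite -/u mulrA -exprD subnKC // -e1 mulrC.
    have [alow atop] := all _ _ e2.
    rewrite ex -natrB // /alpha gridE // atop; split=> // y ylt.
    case: (gridP M_gt0 y) => [[j ey]|-> //]; rewrite ey gridE //; apply: alow.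
    by move: ylt; rewrite ey ltr_pM2r ?invr_gt0 // ltr_nat.
  (* For [V < e] the exponent [x] is negative, where [grid] vanishes; consistently [F = 0], the
     residue of a multiple of [u]. *)
  have x0 : x < 0 by rewrite ex pmulr_llt0 ?invr_gt0 // subr_lt0 ltr_nat.
  have neg y : y < 0 -> alpha y = 0.
    move=> y0; rewrite /alpha; case: (gridP M_gt0 y) => [[j ey]|-> //].
    by move: y0; rewrite ey pmulr_llt0 ?invr_gt0 // ltrn0.
  split=> [y yx|]; first by apply: neg; apply: lt_trans x0.
  rewrite neg // -rg1.
  have -> : g1 = u ^+ (e - V) * ev P.
    apply: (unifX_inj U (m := V)); rewrite -/u mulrA -exprD subnKC ?(ltnW Ve) //.
    by rewrite -e1 mulrC.
  by rewrite -(subnSK Ve) exprS !rmorphM (unif_red U) !mul0r.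
have vpL : Lnz p g -> exists v, vp p teich g = v /\ alpha v != 0.
  move=> /(Lnz_expansion fa fg) [y ay].
  have [v [av vmin]] := grid_well_ordered M_gt0 (c := al) (fun _ => id) (ex_intro _ y ay).
  exists v; split=> //; apply: (vp_expansion fa fg) => // z zv.
  by apply/eqP/negP => /negP /vmin; rewrite leNgt zv.
split.
- by rewrite (Cx_expansion fa fg).
- move=> F0; split; first by apply/(Lnz_expansion fa fg); exists x; rewrite ax.
  by apply: (vp_expansion fa fg) => //; rewrite ax.
- move=> /vpL [v [-> av]]; rewrite leNgt; apply/negP => /low v0.
  by rewrite v0 eqxx in av.
move=> /vpL [v [-> av]] F0; rewrite lt_neqAle; apply/andP; split.
  by apply/eqP => xv; rewrite -xv ax F0 eqxx in av.
by rewrite leNgt; apply/negP => /low v0; rewrite v0 eqxx in av.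
Qed.

End Bridge.
End TeichmuellerExpansion.

(** * Newton polygons *)

Lemma finite_gap (N : nat) (P : nat -> Prop) (f : nat -> rat) :
  (forall j, (j <= N)%N -> P j -> 0 < f j) ->
  exists2 eps : rat, 0 < eps & forall j, (j <= N)%N -> P j -> eps < f j.
Proof.
elim: N => [|N IH] H.
  have [P0|nP] := excluded_middle_informative (P 0%N).
    exists (f 0%N / 2); first by have := H 0%N isT P0; lra.
    by case=> // _ _; have := H 0%N isT P0; lra.
  by exists 1 => // -[].
have [j jN Pj|eps e0 He] := IH; first by apply: H => //; apply: leqW.
have [PN|nP] := excluded_middle_informative (P N.+1); last first.
  exists eps => // j; rewrite leq_eqVlt => /orP[/eqP -> //|jN]; exact: He.
have fN := H _ (leqnn _) PN.
exists (Num.min eps (f N.+1 / 2)).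
  by rewrite lt_min e0; lra.
move=> j; rewrite leq_eqVlt => /orP[/eqP -> _|jN Pj].
  by rewrite gt_min; apply/orP; right; lra.
by rewrite gt_min He.
Qed.

Section NewtonPolygon.
Variables (p : nat) (k : closedFieldType) (Wk : comUnitRingType) (teich : k -> Wk).
Variables (N q : nat) (a : nat -> fsum Wk) (F : {poly k}) (kappa sigma : rat).
Hypotheses (q_gt0 : (0 < q)%N) (qN : (q <= N)%N).
Hypotheses (F0 : F`_0 != 0) (Fq : F`_q != 0) (sizeF : (size F <= q.+1)%N).
Hypothesis aP : forall j, (j <= N)%N -> let x := kappa - sigma * j%:R in
  [/\ Cx p teich x (a (N - j)%N) = F`_j,
      F`_j != 0 -> Lnz p (a (N - j)%N) /\ vp p teich (a (N - j)%N) = x,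
      Lnz p (a (N - j)%N) -> x <= vp p teich (a (N - j)%N)
    & Lnz p (a (N - j)%N) -> F`_j = 0 -> x < vp p teich (a (N - j)%N)].

Let vp0 : Lnz p (a N) /\ vp p teich (a N) = kappa.
Proof.
have [_ + _ _] := aP (leq0n N); rewrite subn0 => /(_ F0) [nz ->].
by rewrite mulr0 subr0.
Qed.

Let vpq : Lnz p (a (N - q)%N) /\ vp p teich (a (N - q)%N) = kappa - sigma * q%:R.
Proof. by have [_ + _ _] := aP qN; apply. Qed.

(** The line of slope [sigma] touches both ends of the side, so it is tilted to [sigma - eps] about
    the left end. This clears the points on the right at once, and those on the left if [eps] is
    below their gaps divided by [j]. *)
Lemma newton_vertex : np_vertex p teich N a (N - q).
Proof.
split; first exact: leq_subr.
split; first by case: vpq.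
have [j jN [Lj qj]|eps e0 He] := @finite_gap N
    (fun j => Lnz p (a (N - j)%N) /\ (q < j)%N)
    (fun j => (vp p teich (a (N - j)%N) - (kappa - sigma * j%:R)) / j%:R).
  have [_ _ _ /(_ Lj)] := aP jN; rewrite nth_default ?(leq_trans sizeF) // => /(_ erefl) lt.
  by rewrite divr_gt0 ?subr_gt0 // ltr0n; lia.
exists (sigma - eps) => m mN mq Lm; rewrite (proj2 vpq).
have [j jN em] : exists2 j, (j <= N)%N & m = (N - j)%N.
  by exists (N - m)%N; rewrite ?leq_subr ?subKn.
rewrite em in Lm *.
rewrite !natrB //.
case: (ltngtP j q) => jq.
- have [_ _ /(_ Lm) + _] := aP jN.
  have : 0 < eps * (q%:R - j%:R) by rewrite mulr_gt0 // subr_gt0 ltr_nat.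
  by move: (vp _ _ _) => v; nra.
- have := He j jN (conj Lm jq); have j0 : (0 < j%:R :> rat) by rewrite ltr0n; lia.
  rewrite ltr_pdivlMr //; have : 0 < eps * q%:R by rewrite mulr_gt0 // ltr0n.
  by move: (vp _ _ _) => v; nra.
- by move: mq; rewrite em jq eqxx.
Qed.

(** A vertex strictly between [N - q] and [N] would lie strictly below the chord of slope [sigma],
    but all points lie on or above it. *)
Lemma newton_m_max : m_max p teich N a = (N - q)%N.
Proof.
apply/eqP; rewrite eqn_leq; apply/andP; split; last first.
  have lt : (N - q < N)%N by lia.
  have := @leq_bigmax_cond _ (fun j : 'I_N => pb (np_vertex p teich N a j))
    (fun j => j : nat) (Ordinal lt); apply.
  by apply/pbP; apply: newton_vertex.
apply/bigmax_leqP => -[m mN] /pbP [_ [Lm [t ht]]] /=; rewrite /= in Lm ht.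
rewrite leqNgt; apply/negP => qm.
have [j jN em] : exists2 j, (j <= N)%N & m = (N - j)%N.
  by exists (N - m)%N; rewrite ?leq_subr ?subKn // ltnW.
have [_ _ + _] := aP jN; rewrite -em => /(_ Lm).
have := ht N (leqnn N) _ (proj1 vp0); rewrite (proj2 vp0) => /(_ _).
have -> : N != m by rewrite neq_ltn mN orbT.
move=> /(_ isT); have := ht (N - q)%N (leq_subr _ _) _ (proj1 vpq).
have -> : (N - q)%N != m by rewrite neq_ltn qm.
move=> /(_ isT); rewrite (proj2 vpq) {2 4}em !natrB //.
have : (j%:R < q%:R :> rat) by rewrite ltr_nat; lia.
have : (0 < j%:R :> rat) by rewrite ltr0n; lia.
by move: (vp _ _ _) => v; nra.
Qed.

Lemma newton_s_max : s_max p teich N a = sigma.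
Proof.
rewrite /s_max newton_m_max (proj2 vp0) (proj2 vpq) subKn //.
by field; rewrite pnatr_eq0 -lt0n.
Qed.

Lemma newton_res_poly : res_poly p teich N a = F.
Proof.
apply/polyP => j; rewrite /res_poly newton_s_max newton_m_max coef_poly subKn //.
case: ltnP => [jq|qj]; last by rewrite nth_default ?(leq_trans sizeF).
have [<- _ _ _] := aP (leq_trans (jq : (j <= q)%N) qN).
congr (Cx _ _ _ _); rewrite (proj2 vpq) natrB //; ring.
Qed.

End NewtonPolygon.

Lemma coef_shifted_power (A : comNzRingType) (b c : A) m j :
  ((b%:P + c%:P * 'X) ^+ m)`_j = 'C(m, j)%:R * b ^+ (m - j) * c ^+ j.
Proof.
rewrite exprDn coef_sum.
have E (i : 'I_m.+1) : (b%:P ^+ (m - i) * (c%:P * 'X) ^+ i *+ 'C(m, i))`_j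
    = if j == i then 'C(m, j)%:R * b ^+ (m - j) * c ^+ j else 0.
  rewrite coefMn exprMn mulrA -!rmorphXn /= -rmorphM /= coefCM coefXn.
  by case: eqP => [->|_]; rewrite ?mulr1 ?mulr0 ?mul0rn // -[LHS]mulr_natl mulrA.
under eq_bigr do rewrite E.
have [jm|mj] := ltnP j m.+1.
  rewrite (bigD1 (Ordinal jm)) //= eqxx big1 ?addr0 // => i.
  by rewrite -val_eqE /= eq_sym => /negPf ->.
rewrite bin_small // !mul0r big1 // => i _.
by case: ifP.
Qed.

Section PhiShift.
Variables (p n M : nat) (M_gt0 : (0 < M)%N) (Wk : comUnitRingType).

Lemma rep_phi_shift (b : fsum Wk) (P : {poly Wk}) m : rep M b P ->
  rep M (phi_shift p n b m)
    (\sum_(i < p) ('C(p ^ n.-1 * i, degN p n - m))%:R *: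
        P ^+ (p ^ n.-1 * i - (degN p n - m))).
Proof.
move=> rb; apply: (rep_big _ (P := fun i => ('C(p ^ n.-1 * i, degN p n - m))%:R *:
        P ^+ (p ^ n.-1 * i - (degN p n - m)))) => i.
by apply: rep_scale; apply: rep_exp.
Qed.

Lemma ev_phi_shift (A : comNzRingType) (ev : {rmorphism {poly Wk} -> A}) (P : {poly Wk}) s j :
  ev (\sum_(i < p) ('C(p ^ n.-1 * i, j))%:R *: P ^+ (p ^ n.-1 * i - j)) * ev 'X ^+ (s * j)
  = (\sum_(i < p) ((ev P)%:P + (ev 'X ^+ s)%:P * 'X) ^+ (p ^ n.-1 * i))`_j.
Proof.
rewrite coef_sum rmorph_sum /= mulr_suml; apply: eq_bigr => i _.
by rewrite coef_shifted_power -mul_polyC rmorphM rmorphXn /= polyC_natr rmorph_nat exprM.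
Qed.

End PhiShift.

(** * The Newton algorithm on the cyclotomic polynomial *)

Lemma frobenius_inj (p m : nat) (k : fieldType) (x y : k) :
  p \in [pchar k] -> x ^+ (p ^ m) = y ^+ (p ^ m) -> x = y.
Proof.
move=> pch; elim: m => [|m IH]; first by rewrite expn0 !expr1.
rewrite expnSr !exprM => e; apply: IH; move: e.
rewrite -!(pFrobenius_autE pch); exact: fmorph_inj.
Qed.

Section NewtonAlgorithm.
Variables (p e : nat) (k : closedFieldType) (Wk : comUnitRingType).
Variables (red : {rmorphism Wk -> k}) (teich : k -> Wk) (z1 : k).
Hypotheses (p_pr : prime p) (p_gt2 : (2 < p)%N).
Hypotheses (Fp : is_Fpbar p k) (WW : is_Witt p red teich).
Hypothesis z1p : z1 ^+ p.-1 = -1.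

Let n := e.+2.
Let N := degN p n.
Let q := (p ^ e.+1)%N.

Let p_gt0 : (0 < p)%N. Proof. exact: prime_gt0. Qed.
Let q_gt0 : (0 < q)%N. Proof. by rewrite expn_gt0 p_gt0. Qed.
Let NE : N = (q * p.-1)%N. Proof. by []. Qed.

Definition ramification (l : nat) := (p * p ^ (e + l) * p.-1)%N.

Lemma ramification_gt0 l : (0 < ramification l)%N.
Proof. by rewrite /ramification !muln_gt0 expn_gt0 p_gt0 /=; lia. Qed.

Section Step.
Variable l : nat.
Let M := ramification l.
Let M_gt0 : (0 < M)%N := ramification_gt0 l.
Variables (A : comNzRingType) (rho : {rmorphism A -> k}) (ev : {rmorphism {poly Wk} -> A}).
Hypothesis U : uniformizer rho (ev 'X).
Hypothesis uM : ev 'X ^+ M = p%:R.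
Hypothesis ev_surj : forall a, exists P, a = ev P.
Hypothesis ev_ker : forall P, ev P = 0 -> exists S, P = ('X^M - (p%:R)%:P) * S.
Hypothesis rho_ev : forall P, rho (ev P) = red P`_0.

(** [d] is the width of the last side; nonzero coefficients of [F] in degrees [0] and [d] fix its
    two ends. *)
Lemma newton_step (b : fsum Wk) (P : {poly Wk}) (V s d : nat) (F : {poly k}) :
  rep M b P -> (0 < d <= N)%N -> F`_0 != 0 -> F`_d != 0 -> (size F <= d.+1)%N ->
  lead (map_poly rho) (ev 'X)%:P V
    (\sum_(i < p) ((ev P)%:P + (ev 'X ^+ s)%:P * 'X) ^+ (q * i)) F ->
  s_max p teich N (phi_shift p n b) = s%:R / M%:R /\
  res_poly p teich N (phi_shift p n b) = F.
Proof.
move=> rb /andP[d0 dN] F0 Fd sF lF.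
have aP j : (j <= N)%N -> let x := V%:R / M%:R - s%:R / M%:R * j%:R in
  [/\ Cx p teich x (phi_shift p n b (N - j)) = F`_j,
      F`_j != 0 -> Lnz p (phi_shift p n b (N - j)) /\
                   vp p teich (phi_shift p n b (N - j)) = x,
      Lnz p (phi_shift p n b (N - j)) -> x <= vp p teich (phi_shift p n b (N - j))
    & Lnz p (phi_shift p n b (N - j)) -> F`_j = 0 ->
      x < vp p teich (phi_shift p n b (N - j))].
  move=> jN x; have := rep_phi_shift p n (N - j) rb; rewrite -/N subKn // => rj.
  apply: (lead_expansion p_pr p_gt2 WW M_gt0 U ev_surj ev_ker rho_ev (V := V) (e := (s * j)%N) rj).
    by rewrite ev_phi_shift; exact: (lead_coef_poly lF).
  by rewrite /x natrM; ring.
split; first exact: newton_s_max d0 dN F0 Fd sF aP.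
exact: newton_res_poly d0 dN F0 Fd sF aP.
Qed.

Let emb : {rmorphism Wk -> A} := ev \o polyC.
Let a := emb (teich z1).
Let C j := emb (inv_fact teich j).

Lemma step_truncexp x : exists r s,
  truncexp p C x ^+ p = \sum_(k < p) C k * x ^+ (k * p) + p%:R * x
    + p%:R ^+ 2 * x * r + p%:R * x ^+ p * s.
Proof.
have [R [S eRS]] := truncexp_pow p_pr (witt_reg WW) (inv_fact0 p_pr p_gt2 WW)
  (inv_factS p_pr p_gt2 Fp WW) (fun m _ => inv_fact_frobenius p_pr Fp WW m).
exists (map_poly emb R).[x], (map_poly emb S).[x].
have nat_h (m : nat) : (m%:R : {poly A}).[x] = m%:R by rewrite -polyC_natr hornerC.
have sum_h (f : nat -> nat) :
    (map_poly emb (\sum_(i < p) inv_fact teich i *: 'X^(f i))).[x]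
      = \sum_(i < p) C i * x ^+ (f i).
  rewrite rmorph_sum horner_sum; apply: eq_bigr => i _.
  by rewrite /= map_polyZ hornerZ map_polyXn hornerXn.
have := congr1 (fun Q => (map_poly emb Q).[x]) eRS.
rewrite poly_def !rmorphD rmorphXn horner_exp (sum_h id) !rmorphM !rmorphXn !rmorph_nat.
by rewrite !hornerD (sum_h (muln^~ p)) !hornerM !horner_exp /= map_polyX hornerX nat_h.
Qed.

Lemma step_ap : a ^+ p.-1 = -1.
Proof.
by rewrite /a -rmorphXn /= -(teichX p_pr p_gt2 WW) z1p (teichN1 p_pr p_gt2 WW) !rmorphN !rmorph1.
Qed.

Lemma step_C0 : C 0%N = 1.
Proof. by rewrite /C (inv_fact0 p_pr p_gt2 WW) rmorph1. Qed.

Lemma step_C1 : C 1%N = 1.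
Proof. by rewrite /C (inv_fact1 p_pr p_gt2 WW) rmorph1. Qed.

Lemma step_Cp m : (m < p)%N -> C m ^+ p = C m.
Proof. by move=> _; rewrite /C -rmorphXn (inv_fact_frobenius p_pr Fp WW). Qed.

Lemma z1_neq0 : z1 != 0.
Proof.
apply/eqP => z0; move: z1p; rewrite z0 expr0n (_ : (p.-1 == 0)%N = false); last by lia.
by move/esym/eqP; rewrite oppr_eq0 oner_eq0.
Qed.

Lemma cluster_step (b : fsum Wk) (P : {poly Wk}) (s : nat) (zi : k) : zi != 0 ->
  rep M b P -> (p * p ^ (e + l) < s * q)%N -> (s * p ^ e < p * p ^ (e + l))%N ->
  lead rho (ev 'X) (s * q)
    (ev P ^+ q - truncexp p C ((a * ev 'X ^+ (p ^ l)) ^+ q)) (- zi ^+ q) ->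
  s_max p teich N (phi_shift p n b) = s%:R / M%:R /\
  forall z, root (res_poly p teich N (phi_shift p n b)) z -> z = zi.
Proof.
move=> zi0 rb s1 s2 lb.
have lF := lead_phi p_pr p_gt2 U uM step_ap step_C0 step_C1 step_truncexp s1 s2 lb.
rewrite -/q in lF.
have a0 : (rho a ^+ q)^-1 != 0.
  by rewrite invr_eq0 expf_neq0 // (rho_a_neq0 p_gt2 rho step_ap).
have q1 : (q == 0)%N = false by lia.
have dq : (0 < q <= N)%N by rewrite q_gt0 NE leq_pmulr //; lia.
have [|||-> ->] := newton_step rb dq _ _ _ lF.
- rewrite coefZ coefB coefXn coefC eqxx [(0 == q)%N]eq_sym q1 sub0r mulf_neq0 //.
  by rewrite oppr_eq0 expf_neq0.
- by rewrite coefZ coefB coefXn coefC eqxx q1 subr0 mulr1.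
- by rewrite size_scale // size_XnsubC.
split=> // z; rewrite rootE hornerZ mulf_eq0 (negPf a0) /= !hornerE subr_eq0.
rewrite ?hornerXn => /eqP; apply: frobenius_inj; by case: Fp.
Qed.

End Step.

Lemma ramified_ring l : exists (A : comNzRingType) (rho : {rmorphism A -> k})
    (ev : {rmorphism {poly Wk} -> A}),
  [/\ uniformizer rho (ev 'X), ev 'X ^+ ramification l = p%:R,
      forall a, exists P, a = ev P,
      forall P, ev P = 0 -> exists S, P = ('X^(ramification l) - (p%:R)%:P) * S
    & forall P, rho (ev P) = red P`_0].
Proof.
exact: (eisenstein_extension (ramification_gt0 l) (witt_ker WW) (witt_reg WW)).
Qed.

(** The constant and the top coefficient are both 1, so the polygon is a horizontal segment. *)
Lemma s_max_start : s_max p teich N (phi_shift p n (fs0 Wk)) = 0.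
Proof.
have [A [rho [ev [U uM surj ker re]]]] := ramified_ring 0.
pose F : {poly k} := \sum_(i < p) 'X^(q * i).
have coefF j : F`_j = \sum_(i < p) (j == (q * i)%N)%:R.
  by rewrite coef_sum; apply: eq_bigr => i _; rewrite coefXn.
have coefF1 (i : 'I_p) : F`_(q * i) = 1.
  rewrite coefF (bigD1 i) //= eqxx big1 ?addr0 // => j ji.
  by rewrite eqn_pmul2l // eq_sym val_eqE (negPf ji).
have lF : lead (map_poly rho) (ev 'X)%:P 0
    (\sum_(i < p) ((ev 0)%:P + (ev 'X ^+ 0)%:P * 'X) ^+ (q * i)) F.
  have -> : F = map_poly rho (\sum_(i < p) ((ev 0)%:P + (ev 'X ^+ 0)%:P * 'X) ^+ (q * i)).
    rewrite rmorph_sum; apply: eq_bigr => i _.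
    by rewrite rmorph0 polyC0 add0r expr0 polyC1 mul1r /= map_polyXn.
  exact: lead_unit.
have N_gt0 : (0 < N <= N)%N by rewrite leqnn NE muln_gt0 q_gt0; lia.
have pl : (p.-1 < p)%N by lia.
have [|||-> _] := newton_step U surj ker re (rep0 _ _) N_gt0 _ _ _ lF.
- by have := coefF1 (Ordinal p_gt0); rewrite /= muln0 => ->; rewrite oner_eq0.
- by have := coefF1 (Ordinal pl); rewrite /= -NE => ->; rewrite oner_eq0.
- apply/leq_sizeP => j jN; rewrite coefF big1 // => i _.
  rewrite gtn_eqF //; apply: leq_ltn_trans jN; rewrite NE leq_mul2l -ltnS prednK //.
  by rewrite ltn_ord orbT.
by rewrite mul0r.
Qed.

(** The residue polynomial ['X^N + 1] is the [q]-th power of ['X^(p-1) + 1], so it does not single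
    out a digit; only the slope is extracted. *)
Lemma s_max_one : s_max p teich N (phi_shift p n [:: (0, 1)]) = 1 / N%:R.
Proof.
have [A [rho [ev [U uM surj ker re]]]] := ramified_ring 0.
have := lead_phi1 p_pr p_gt2 U uM; rewrite /shifted_phi -(rmorph1 ev) => lF.
have NM : ramification 0 = N by rewrite /ramification NE addn0 /q expnS.
have N_gt0 : (0 < N <= N)%N by rewrite leqnn NE muln_gt0 q_gt0; lia.
have N0 : (N == 0)%N = false by lia.
have [|||-> _] := newton_step U surj ker re (rep1 _ _) N_gt0 _ _ _ lF.
- by rewrite coefD coefXn coef1 -/q -NE eqxx [(0 == N)%N]eq_sym N0 add0r oner_eq0.
- by rewrite coefD coefXn coef1 -/q -NE eqxx N0 addr0 oner_eq0.
- by rewrite -/q -NE size_XnaddC //; lia.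
by rewrite NM expn0.
Qed.

Lemma rep_map M (s : seq nat) (f : nat -> nat) (c : nat -> Wk) :
  rep M [seq ((f j)%:R / M%:R, c j) | j <- s] (\sum_(j <- s) c j *: 'X^(f j)).
Proof.
exists [seq (f j, c j) | j <- s]; rewrite -map_comp; split=> //.
by rewrite big_map.
Qed.

Definition digit (j : nat) : k := if (j < p)%N then z1 ^+ j * (j`!%:R)^-1 else z1.

Definition slope (j : nat) : rat :=
  if (j < p)%N then j%:R / N%:R else 1 / (p ^ e * p.-1)%:R - 1 / (p ^ (j - p + n))%:R.

(** The terms come in the order in which [approx] appends them, so that the two are equal as
    lists. *)
Definition expected (i : nat) : fsum Wk := [seq (slope j, teich (digit j)) | j <- iota 0 i].

Lemma digit_neq0 j : digit j != 0.
Proof.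
rewrite /digit; case: ifP => jp; last exact: z1_neq0.
by rewrite mulf_neq0 ?expf_neq0 ?z1_neq0 // invr_eq0 (natr_fact_neq0 p_pr p_gt2 Fp).
Qed.

Lemma step_small i : (1 < i < p)%N ->
  s_max p teich N (phi_shift p n (expected i)) = slope i /\
  forall z, root (res_poly p teich N (phi_shift p n (expected i))) z -> z = digit i.
Proof.
move=> /andP[i1 ip].
have [A [rho [ev [U uM surj ker re]]]] := ramified_ring 0.
have NM : ramification 0 = N by rewrite /ramification NE addn0 /q expnS.
have rb : rep (ramification 0) (expected i)
    (\sum_(j <- iota 0 i) teich (digit j) *: 'X^j).
  have := rep_map (ramification 0) (iota 0 i) id (fun j => teich (digit j)).
  congr (rep _ _ _); apply/eq_in_map => j; rewrite mem_iota /= => ji.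
  by rewrite /slope (ltn_trans ji ip) NM.
pose emb : {rmorphism Wk -> A} := ev \o polyC.
have evP : ev (\sum_(j <- iota 0 i) teich (digit j) *: 'X^j) =
    \sum_(j < i) emb (inv_fact teich j) * (emb (teich z1) * ev 'X ^+ (p ^ 0)) ^+ j.
  rewrite -(big_mkord xpredT (fun j => emb (inv_fact teich j) *
     (emb (teich z1) * ev 'X ^+ (p ^ 0)) ^+ j)) /index_iota subn0 rmorph_sum.
  rewrite big_seq [RHS]big_seq; apply: eq_bigr => j; rewrite mem_iota /= => ji.
  rewrite /digit (ltn_trans ji ip) -mul_polyC rmorphM rmorphXn (teichM WW).
  by rewrite (teichX p_pr p_gt2 WW) /= polyCM rmorphM !rmorphXn expn0 expr1 exprMn; ring.
have := lead_prefix p_pr p_gt2 U uM (emb (teich z1)) (@step_Cp A ev) (@step_truncexp A ev)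
  (i := i); rewrite i1 ip => /(_ isT).
rewrite -evP addn0 -expnS => lb.
have zE : rho (emb (inv_fact teich i) * emb (teich z1) ^+ i) = digit i.
  by rewrite rmorphM rmorphXn /= !re !coefC /= !(teichK WW) /digit ip mulrC.
have [|||-> zP] := cluster_step U uM surj ker re (digit_neq0 i) rb (s := i).
- by rewrite addn0 -expnS -/q -[X in (X < _)%N]mul1n ltn_mul2r q_gt0.
- by rewrite addn0 ltn_mul2r expn_gt0 p_gt0.
- by rewrite -zE.
by rewrite /slope ip NM.
Qed.

Lemma tail_ratio l m : (m < l)%N ->
  (tail_val p l m)%:R / (ramification l)%:R
    = 1 / (p ^ e * p.-1)%:R - 1 / (p ^ (m + n))%:R :> rat.
Proof.
move=> ml; have [d ->] : exists d, l = (m + d).+1 by exists (l - m.+1)%N; lia.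
have P0 : p%:R != 0 :> rat by rewrite pnatr_eq0 -lt0n.
have Q0 : p.-1%:R != 0 :> rat by rewrite pnatr_eq0 -lt0n; lia.
have le : (p ^ d * p.-1 <= p ^ (m + d).+2)%N.
  by rewrite -addn2 addnAC addnC expnD leq_mul2l expnD; apply/orP; right;
     have : (0 < p ^ m)%N by [rewrite expn_gt0 p_gt0]; nia.
rewrite /tail_val /ramification succnK addKn natrB // !natrX !natrM !natrX /n.
rewrite !(exprS, exprD, addnS, addSn); field.
by rewrite P0 Q0 !expf_neq0.
Qed.

Lemma step_large i : (p <= i)%N ->
  s_max p teich N (phi_shift p n (expected i)) = slope i /\
  forall z, root (res_poly p teich N (phi_shift p n (expected i))) z -> z = digit i.
Proof.
(* [j] tail terms are present; level [j.+1] makes the next exponent [tail_val p l j] integral as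
   well. *)
move=> pi; pose j := (i - p)%N; pose l := j.+1.
have [A [rho [ev [U uM surj ker re]]]] := ramified_ring l.
pose M := ramification l.
pose P : {poly Wk} := \sum_(m <- iota 0 p) teich (digit m) *: 'X^(p ^ l * m)
   + \sum_(m <- iota 0 j) teich z1 *: 'X^(tail_val p l m).
have rb : rep M (expected i) P.
  have r1 := rep_map M (iota 0 p) (fun m => p ^ l * m)%N (fun m => teich (digit m)).
  have r2 := rep_map M (iota 0 j) (tail_val p l) (fun=> teich z1).
  have := rep_cat r1 r2; congr (rep _ _ _).
  rewrite /expected -(subnKC pi) iotaD map_cat /fsadd; congr (_ ++ _).
    apply/eq_in_map => m; rewrite mem_iota /= => mp.
    rewrite /slope mp /M /ramification NE /q addnC expnD expnS !natrM.
    have P0 (a : nat) : (p ^ a)%:R != 0 :> rat by rewrite pnatr_eq0 -lt0n expn_gt0 p_gt0.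
    have p0 : p%:R != 0 :> rat by rewrite pnatr_eq0 -lt0n.
    have Q0 : p.-1%:R != 0 :> rat by rewrite pnatr_eq0 -lt0n; lia.
    by congr (_, _); field; rewrite !P0 p0 Q0.
  rewrite add0n -[X in iota X (i - p)]addn0 iotaDl -map_comp; apply/eq_in_map => m; rewrite mem_iota /= => mj.
  rewrite /slope /digit ltnNge leq_addr /= addKn; congr (_, _).
  by rewrite tail_ratio // ltnW.
pose emb : {rmorphism Wk -> A} := ev \o polyC.
have evP : ev P = long_prefix p l (ev 'X) (emb (teich z1)) (fun m => emb (inv_fact teich m)) j.
  rewrite /P /long_prefix /truncexp rmorphD !rmorph_sum /=; congr (_ + _).
    rewrite -(big_mkord xpredT (fun m => emb (inv_fact teich m) *
       (emb (teich z1) * ev 'X ^+ (p ^ l)) ^+ m)) /index_iota subn0.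
    rewrite big_seq [RHS]big_seq; apply: eq_bigr => m; rewrite mem_iota /= => mp.
    rewrite /digit mp -mul_polyC rmorphM rmorphXn (teichM WW) (teichX p_pr p_gt2 WW).
    by rewrite /= polyCM rmorphM !rmorphXn exprM exprMn; ring.
  rewrite -(big_mkord xpredT (fun m => emb (teich z1) * ev 'X ^+ tail_val p l m)).
  rewrite /index_iota subn0; apply: eq_bigr => m _.
  by rewrite -mul_polyC rmorphM rmorphXn.
have jl : (j < l)%N by [].
have lb := lead_long_prefix p_pr p_gt2 U uM (@step_ap A ev) (@step_C0 A ev) (@step_C1 A ev)
  (@step_Cp A ev) (@step_truncexp A ev) jl.
have zE : rho (emb (teich z1)) = digit i.
  by rewrite /= re coefC /= (teichK WW) /digit ltnNge pi.
rewrite -evP zE in lb.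
have p1 : (0 < p ^ e * p.-1)%N by rewrite muln_gt0 expn_gt0 p_gt0; lia.
have [||-> zP] := cluster_step U uM surj ker re (digit_neq0 i) rb _ _ lb.
- rewrite tail_val_mulq // subSnn expn1.
  have : (p ^ e * p * p.-1 < p * p ^ (e + l) * p.-1)%N.
    by rewrite ltn_mul2r mulnC ltn_pmul2l // ltn_exp2l; lia.
  by lia.
- rewrite tail_val_mulpe //= subnn expn0 muln1 ltn_subrL p1 muln_gt0 p_gt0.
  by rewrite expn_gt0 p_gt0.
by rewrite /slope ltnNge pi /= -/j -/M tail_ratio.
Qed.

Lemma approx_expected (z : nat -> k) : z 0%N = 1 -> z 1%N = z1 ->
  (forall i, (2 <= i)%N -> root (residue_at p n teich z i) (z i)) ->
  forall i, approx p n teich z i = expected i.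
Proof.
move=> z0 zz1 zr; elim=> [//|i IH].
rewrite /= /expected -addn1 iotaD map_cat -/(expected i) -IH /= add0n.
suff [-> ->] : s_max p teich N (phi_shift p n (approx p n teich z i)) = slope i /\ z i = digit i by [].
(* In the first two cases the digit is prescribed and only the slope is computed; afterwards the
   root hypothesis forces the digit. *)
case: i IH => [|[|i]] IH.
- rewrite [approx _ _ _ _ _]/= s_max_start /slope /digit p_gt0 mul0r z0 fact0 expr0 invr1 mulr1.
  by [].
- have p1 : (1 < p)%N by lia.
  have -> : approx p n teich z 1 = [:: (0, 1)].
    by rewrite IH /expected /= /slope /digit p_gt0 mul0r expr0 fact0 invr1 mulr1 (teich1 p_pr p_gt2 WW).
  by rewrite s_max_one /slope /digit p1 zz1 expr1 invr1 mulr1.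
have := zr i.+2 isT; rewrite /residue_at -/N IH.
case: (ltnP i.+2 p) => ip.
  by have [|-> zP] := @step_small i.+2; [rewrite ip | move=> /zP].
by have [-> zP] := step_large ip; move=> /zP.
Qed.

End NewtonAlgorithm.

Theorem theorem3p3 (p n : nat) (k : closedFieldType) (Wk : comUnitRingType)
    (red : {rmorphism Wk -> k}) (teich : k -> Wk) (zeta : k) (z : nat -> k) :
  prime p -> (3 <= p)%N -> (2 <= n)%N ->
  is_Fpbar p k -> is_Witt p red teich ->
  (2 * p.-1)%N.-primitive_root zeta ->
  z 0%N = 1 -> z 1%N = (-1) ^+ n * zeta ->
  (forall i : nat, (2 <= i)%N -> root (residue_at p n teich z i) (z i)) ->
  forall i : nat,
    Leq p (approx p n teich z i.+1)
      (if (i <= p.-1)%N then rhs1 p n teich zeta i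
       else fsadd (approx p n teich z p) (rhs2 p n teich zeta i)).
Proof.
move=> p_pr p_gt2 n2 Fp WW zp z0 z1 zr i.
have p_gt0 := prime_gt0 p_pr.
case: n n2 z1 zr => [|[|e]] // _ z1 zr.
have zetap : zeta ^+ p.-1 = -1.
  have := prim_expr_order zp; rewrite mulnC exprM => /eqP; rewrite sqrf_eq1.
  case/orP => [/eqP e1|/eqP //].
  have := prim_order_dvd zp p.-1; rewrite e1 eqxx => dv_p.
  by have := dvdn_leq _ dv_p; lia.
have z1p : ((-1) ^+ e.+2 * zeta) ^+ p.-1 = -1.
  have op := odd_p p_pr p_gt2.
  rewrite exprMn zetap -exprM -signr_odd oddM.
  by rewrite (_ : odd p.-1 = false) ?andbF ?mul1r //; lia.
have teichz1 : teich ((-1) ^+ e.+2 * zeta) = (-1) ^+ e.+2 * teich zeta.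
  by rewrite (teichM WW) (teichX p_pr p_gt2 WW) (teichN1 p_pr p_gt2 WW).
have ap := approx_expected p_pr p_gt2 Fp WW z1p z0 z1 zr.
(* The two sides agree as lists, so the multiple of [t - p] is zero. *)
suff -> : approx p e.+2 teich z i.+1 = (if (i <= p.-1)%N then rhs1 p e.+2 teich zeta i
       else fsadd (approx p e.+2 teich z p) (rhs2 p e.+2 teich zeta i)).
  exists (fun=> 0); split; first by move=> X XS [x /XS]; rewrite eqxx.
  by move=> y; rewrite subrr mulr0 subr0.
rewrite !ap; case: leqP => ip.
  rewrite /rhs1 /fsbig flatten_map1; apply/eq_in_map => j; rewrite mem_iota /= => ji.
  have jp : (j < p)%N by lia.
  rewrite /slope /digit jp; congr (_, _).
  rewrite (teichM WW) (teichX p_pr p_gt2 WW) teichz1.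
  rewrite (teichV p_pr p_gt2 WW) ?(natr_fact_neq0 p_pr p_gt2 Fp) // exprMn -exprM.
  by rewrite mulnC mulrAC.
have -> : i.+1 = (p + (i - p).+1)%N by lia.
rewrite /expected iotaD map_cat /fsadd; congr (_ ++ _).
rewrite /rhs2 /fsbig; set F := (X in flatten (map X _)).
(* The sum in [rhs2] starts at [l = 0]; its first [n] entries are empty and are split off. *)
have -> : (i - p + e.+2).+1 = (e.+2 + (i - p).+1)%N by rewrite -addSn addnC.
rewrite iotaD map_cat flatten_cat !add0n.
have -> : [seq F l | l <- iota 0 e.+2] = [seq [::] | l <- iota 0 e.+2].
  by apply/eq_in_map => l; rewrite mem_iota /F add0n => /andP[_ ->].
have -> : flatten [seq [::] | l <- iota 0 e.+2] = [::] :> fsum Wk.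
  by elim: (iota 0 e.+2).
pose g (l : nat) : rat * Wk := ((1 / (p ^ (e.+2 - 2) * p.-1)%:R - 1 / (p ^ l)%:R : rat),
          (-1) ^+ e.+2 * teich zeta).
have -> : [seq F l | l <- iota e.+2 (i - p).+1] = [seq [:: g l] | l <- iota e.+2 (i - p).+1].
  by apply/eq_in_map => l; rewrite mem_iota /F => /andP[le _]; rewrite ltnNge le.
rewrite flatten_map1 cat0s.
have iota_shift m d : iota m d = map (addn m) (iota 0 d) by rewrite -iotaDl addn0.
rewrite iota_shift [iota e.+2 _]iota_shift -!map_comp.
apply: eq_map => m; rewrite /= /slope /digit ltnNge leq_addr /= /g addKn.
by rewrite subn2 teichz1 addnC.
Qed.
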